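(* Let $E$ and $F$ be Banach spaces and $T:E\to F$ an operator. The following are equivalent: (i) there is an ordinal $\alpha$ such that $\mathrm{Sz}(T)\leqslant\omega^\alpha$ (i.e. $T$ is an $\alpha$-Szlenk operator for some ordinal $\alpha$); (ii) $T$ is an Asplund operator.
   Context: Banach spaces are over $\mathbb K\in\{\mathbb R,\mathbb C\}$; an operator is a bounded linear map between Banach spaces; $\mathscr B(E,F)$ is the space of operators $E\to F$; $B_E$ is the closed unit ball of $E$; $T^*$ is the adjoint of $T$. Szlenk index. Let $E$ be a Banach space, $K\subseteq E^*$ a $w^*$-compact set and $\varepsilon>0$. Put $s_\varepsilon(K)=\{x\in K : \operatorname{diam}(K\cap V)>\varepsilon \text{ for every } w^*\text{-open } V\ni x\}$ (norm diameter), $s^0_\varepsilon(K)=K$, $s^{\alpha+1}_\varepsilon(K)=s_\varepsilon(s^\alpha_\varepsilon(K))$, and $s^\alpha_\varepsilon(K)=\bigcap_{\beta<\alpha}s^\beta_\varepsilon(K)$ for limit ordinals $\alpha$. $\mathrm{Sz}_\varepsilon(K)$ is the class of all ordinals $\alpha$ with $s^\alpha_\varepsilon(K)\neq\emptyset$; that is, the least ordinal $\alpha$ with $s^\alpha_\varepsilon(K)=\emptyset$ if one exists, and otherwise the class of all ordinals, written $\infty$. $\mathrm{Sz}(K)=\bigcup_{\varepsilon>0}\mathrm{Sz}_\varepsilon(K)=\sup_{\varepsilon>0}\mathrm{Sz}_\varepsilon(K)$. For an operator $T:E\to F$, $\mathrm{Sz}(T)=\mathrm{Sz}(T^*B_{F^*})$.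 Asplund operators. An operator $T:E\to F$ is Asplund if for any finite positive measure space $(\Omega,\Sigma,\mu)$, any $S\in\mathscr B(F,L_\infty(\Omega,\Sigma,\mu))$ and any $\varepsilon>0$, there exists $B\in\Sigma$ such that $\mu(B)>\mu(\Omega)-\varepsilon$ and $\{f\chi_B : f\in ST(B_E)\}$ is relatively compact in $L_\infty(\Omega,\Sigma,\mu)$, where $\chi_B$ is the characteristic function of $B$. *)

(* Defs.v *)
From HB Require Import structures.
From mathcomp Require Import all_boot all_order all_algebra.
From mathcomp Require Import all_classical all_reals all_analysis.
From mathcomp Require Import measurable_realfun ess_sup_inf hoelder.
From mathcomp.real_closed Require Import complex.
Set Implicit Arguments.
Unset Strict Implicit.
Unset Printing Implicit Defensive.

Import Order.TTheory GRing.Theory Num.Theory.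
Import numFieldNormedType.Exports.

Local Open Scope classical_set_scope.
Local Open Scope ring_scope.

(* Ordinals, as trees modulo [fun a b => ole a b /\ ole b a]: [OSup i0 f] is the
   supremum of the family [f], whose index type is inhabited by [i0].
   They form a well-founded total (pre)order, and [ord_rank] shows that they
   include the rank of every well-founded relation.  A class of ordinals is a
   predicate [ord -> Prop] and not a [set ord]: [set] would force the universe
   of the index types strictly below that of the MathComp structures. *)
Inductive ord : Type :=
| OZero
| OSucc (a : ord)
| OSup (I : Type) (i0 : I) (f : I -> ord).

Fixpoint ole (a : ord) : ord -> Prop :=
  match a with
  | OZero => fun=> True
  | OSucc a' => fix olt_a' (b : ord) : Prop :=
      match b with
      | OZero => False
      | OSucc b' => ole a' b'
      | OSup J _ g => exists j, olt_a' (g j)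
      end
  | OSup J _ f => fun b => forall i, ole (f i) b
  end.

Definition olt (a b : ord) : Prop := ole (OSucc a) b.

Lemma ole_sup a I (i0 : I) f i : ole a (f i) -> ole a (OSup i0 f).
Proof.
elim: a => [//|a _ h|J j0 g IH h j]; first by exists i.
exact: IH (h j).
Qed.

Lemma ole_succ a b : ole a b -> ole a (OSucc b).
Proof.
elim: a b => [//|a IH|J j0 g IH] b; last by move=> h j; apply: IH.
elim: b => [//|b _ h|I i0 f IHb [i h]]; first exact: IH.
by apply: (@ole_sup a I i0 f i); apply: IHb.
Qed.

Lemma oltW a b : olt a b -> ole a b.
Proof. exact: (@ole_succ (OSucc a) b). Qed.

Lemma ole_refl a : ole a a.
Proof. by elim: a => [//|//|I i0 f IH] i; apply: ole_sup (IH i). Qed.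

Lemma ole_trans b a c : ole a b -> ole b c -> ole a c.
Proof.
elim: a b c => [//|a IHa|I i0 f IH] b c; last by move=> ab bc i; apply: IH bc.
elim: b => [//|b _ ab|J j0 g IHb [j h] gc]; last exact: IHb (gc j).
elim: c => [//|c _ bc|J j0 g IHc [j h]]; first exact: (IHa b c ab bc).
by exists j; apply: IHc.
Qed.

Lemma ole_total a b : ole a b \/ olt b a.
Proof.
elim: a b => [|a IH|I i0 f IH] b; first by left.
- elim: b => [|b _|J j0 g IHb]; [by right|exact: IH|].
  have [[j h]|h] := pselect (exists j, olt a (g j)); first by left; exists j.
  by right=> j; case: (IHb j) => // ?; case: h; exists j.
- have [[i h]|h] := pselect (exists i, olt b (f i)); first by right; exists i.
  by left=> i; case: (IH i b) => // ?; case: h; exists i.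
Qed.

Lemma olt_wf : well_founded olt.
Proof.
suff H a b : ole b a -> Acc olt b by move=> a; apply: (H a); exact: ole_refl.
elim: a b => [|a IH|I i0 f IH] b ba; constructor=> c cb.
- by case: (@ole_trans b (OSucc c) OZero cb ba).
- by apply: IH; exact: (@ole_trans b (OSucc c) (OSucc a) cb ba).
- have [i ci] : exists i, olt c (f i) := @ole_trans b (OSucc c) (OSup i0 f) cb ba.
  by apply: (IH i); exact: oltW.
Qed.

Lemma olt_irr a : ~ olt a a.
Proof. by elim/(well_founded_ind olt_wf): a => a IH aa; exact: (IH _ aa aa). Qed.

Lemma ord_rank (A : Type) (lt : A -> A -> Prop) : well_founded lt ->
  exists rk : A -> ord, forall x b, olt b (rk x) <-> exists2 y, lt y x & ole b (rk y).
Proof.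
move=> wf.
pose F x (rec : forall y, lt y x -> ord) : ord :=
  OSup None (fun o : option {y | lt y x} =>
    if o is Some y then OSucc (rec (sval y) (svalP y)) else OZero).
exists (Fix wf (fun=> ord) F) => x b; rewrite Fix_eq /=; last first.
  move=> z f g fg; rewrite /F; congr OSup; apply/funext => -[y|//].
  by rewrite fg.
split=> [[[[y yx]|//]] /= h|[y yx h]]; first by exists y.
by exists (Some (exist _ y yx)).
Qed.


(* In the three operations below the [OSup] clause is the continuity of the
   operation in its second argument; for [oexp] it needs the base to be
   nonzero. *)
Fixpoint oadd (a b : ord) : ord :=
  match b with
  | OZero => a
  | OSucc b' => OSucc (oadd a b')
  | OSup _ i0 f => OSup i0 (fun i => oadd a (f i))
  end.

Fixpoint omul (a b : ord) : ord :=
  match b with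
  | OZero => OZero
  | OSucc b' => oadd (omul a b') a
  | OSup _ i0 f => OSup i0 (fun i => omul a (f i))
  end.

Fixpoint oexp (a b : ord) : ord :=
  match b with
  | OZero => OSucc OZero
  | OSucc b' => omul (oexp a b') a
  | OSup _ i0 f => OSup i0 (fun i => oexp a (f i))
  end.

Definition omega : ord := OSup 0%N (fun n => iter n OSucc OZero).

Definition olimit (a : ord) : Prop :=
  olt OZero a /\ forall b, olt b a -> olt (OSucc b) a.

(* C <= a, where an ordinal is the class of all smaller ordinals. *)
Definition oclass_le (C : ord -> Prop) (a : ord) : Prop :=
  forall b, C b -> olt b a.

(* The two scalar fields, the reals and the complex numbers, treated
   uniformly; [sre] and [sim] are the real and imaginary parts, [sof] embeds
   the reals, [sabs] is the modulus as a real number. *)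
Variant scalars := RealScalars | ComplexScalars.

Definition scalar_field (R : realType) (k : scalars) : numFieldType :=
  match k with
  | RealScalars => R
  | ComplexScalars => R[i]%C
  end.

Section scalars.
Context {R : realType} {k : scalars}.
Local Notation K := (scalar_field R k).

Definition sre : K -> R :=
  match k return scalar_field R k -> R with
  | RealScalars => fun x => x
  | ComplexScalars => fun z => complex.Re z
  end.

Definition sim : K -> R :=
  match k return scalar_field R k -> R with
  | RealScalars => fun=> 0
  | ComplexScalars => fun z => complex.Im z
  end.

Definition sof : R -> K :=
  match k return R -> scalar_field R k with
  | RealScalars => fun x => x
  | ComplexScalars => fun x => (x%:C)%C
  end.

Definition sabs (x : K) : R := sre `|x|.

End scalars.

Lemma sreD (R : realType) k : {morph @sre R k : x y / x + y}.
Proof. by case: k => // -[a b] [c d]. Qed.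
Lemma simD (R : realType) k : {morph @sim R k : x y / x + y}.
Proof. by case: k => [x y|[a b] [c d]] //=; rewrite addr0. Qed.
Lemma sreM (R : realType) k (x y : scalar_field R k) :
  sre (x * y) = sre x * sre y - sim x * sim y.
Proof. by case: k x y => [x y|[a b] [c d]] //=; rewrite mul0r subr0. Qed.
Lemma simM (R : realType) k (x y : scalar_field R k) :
  sim (x * y) = sre x * sim y + sim x * sre y.
Proof. by case: k x y => [x y|[a b] [c d]] //=; rewrite mul0r mulr0 addr0. Qed.
Lemma sabsE (R : realType) k (x : scalar_field R k) :
  sabs x = Num.sqrt (sre x ^+ 2 + sim x ^+ 2).
Proof. by case: k x => [x|[a b]] //=; rewrite /sabs/= expr0n/= addr0 sqrtr_sqr. Qed.
Lemma sof_sabs (R : realType) k (x : scalar_field R k) : sof (sabs x) = `|x|.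
Proof. by case: k x => [x|[a b]]. Qed.
Lemma le_sof (R : realType) k (a b : R) : ((sof a : scalar_field R k) <= sof b) = (a <= b).
Proof. by case: k => //=; rewrite lecR. Qed.
Lemma sofD (R : realType) k : {morph @sof R k : x y / x + y}.
Proof. by case: k => //= x y; rewrite rmorphD. Qed.
Lemma sofM (R : realType) k : {morph @sof R k : x y / x * y}.
Proof. by case: k => //= x y; rewrite rmorphM. Qed.
Lemma sof_eq0 (R : realType) k (a : R) : ((sof a : scalar_field R k) == 0) = (a == 0).
Proof. by case: k => //=; rewrite eq_complex /= eqxx andbT. Qed.

Record operator (K : numFieldType) (E F : normedModType K) := Operator {
  operator_fun :> {linear E -> F};
  operator_bounded : bounded_near operator_fun (nbhs (0 : E)) }.

HB.instance Definition _ (K : numFieldType) (E F : normedModType K) :=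
  gen_eqMixin (operator E F).
HB.instance Definition _ (K : numFieldType) (E F : normedModType K) :=
  gen_choiceMixin (operator E F).

Definition closed_unit_ball (K : numFieldType) (E : normedModType K) : set E :=
  [set x | `|x| <= 1].

Arguments closed_unit_ball {K} E.

Definition dual (K : numFieldType) (E : normedModType K) := operator E K^o.

(* The dual with its weak* topology, i.e. the topology of pointwise
   convergence. *)
Definition wstar_dual (K : numFieldType) (E : normedModType K) :=
  initial_topology (fun f : dual E => (f : E -> K) : {ptws E -> K}).

HB.instance Definition _ (K : numFieldType) (E : normedModType K) :=
  Topological.copy (wstar_dual E)
    (initial_topology (fun f : dual E => (f : E -> K) : {ptws E -> K})).

Section adjoint.
Context {K : numFieldType} {E F : normedModType K}.
Variables (T : operator E F) (f : dual F).

Lemma adjoint_bounded : bounded_near (f \o T : {linear E -> K^o}) (nbhs (0 : E)).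
Proof.
apply/linear_bounded_continuous => x; apply: continuous_comp.
  exact: (linear_bounded_continuous _).1 (operator_bounded T) _.
exact: (linear_bounded_continuous _).1 (operator_bounded f) _.
Qed.

Definition adjoint : dual E := Operator adjoint_bounded.

End adjoint.

Section szlenk.
Context {R : realType} {k : scalars}.
Local Notation K := (scalar_field R k).

Definition functional_norm (E : normedModType K) (f : E -> K) : \bar R :=
  ereal_sup [set (sabs (f x))%:E | x in closed_unit_ball E].

Definition dual_ball (E : normedModType K) : set (wstar_dual E) :=
  [set f : dual E | (functional_norm f <= 1)%E].

(* The diameter for the norm of the dual. *)
Definition dual_diam (E : normedModType K) (A : set (wstar_dual E)) : \bar R :=
  ereal_sup [set functional_norm (fun x => (p.1 : dual E) x - (p.2 : dual E) x)
            | p in A `*` A].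

Section derivation.
Context {E : normedModType K}.
Implicit Types (A : set (wstar_dual E)) (eps : R) (a b : ord).

Definition szlenk_deriv eps A : set (wstar_dual E) :=
  [set x | A x /\ forall V : set (wstar_dual E), open V -> V x ->
             (eps%:E < dual_diam (A `&` V))%E].

(* Since [szlenk_iter] decreases, the intersection over a family cofinal in a
   limit ordinal a is the intersection over all b < a; see
   [szlenk_iter_limit]. *)
Fixpoint szlenk_iter eps A (a : ord) : set (wstar_dual E) :=
  match a with
  | OZero => A
  | OSucc b => szlenk_deriv eps (szlenk_iter eps A b)
  | OSup _ _ f => [set x | forall i, szlenk_iter eps A (f i) x]
  end.

Lemma szlenk_deriv_sub eps A : szlenk_deriv eps A `<=` A.
Proof. by move=> x []. Qed.

Lemma szlenk_derivS eps A B : A `<=` B -> szlenk_deriv eps A `<=` szlenk_deriv eps B.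
Proof.
move=> AB x [Ax h]; split; first exact: AB.
move=> V oV Vx; apply: lt_le_trans (h V oV Vx) _; apply: ereal_sup_le.
move=> _ [[p q] [[Ap Vp] [Aq Vq]] <-]; exists (p, q) => //.
by split; split=> //=; exact: AB.
Qed.

Lemma szlenk_iter_anti eps A a b :
  ole a b -> szlenk_iter eps A b `<=` szlenk_iter eps A a.
Proof.
elim: a b => [|a IH|J j0 f IH] b; last by move=> h x xb j; exact: IH xb.
- move=> _; elim: b => [//|b IHb|J j0 f IHb].
    by move=> x [/IHb].
  by move=> x /(_ j0); exact: IHb.
- elim: b => [//|b _ ab|J j0 g IHb [j h] x xg].
    by apply: szlenk_derivS; exact: IH.
  by apply: (IHb j h); exact: xg.
Qed.

Lemma szlenk_iter_limit eps A a x : olimit a ->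
  szlenk_iter eps A a x <-> forall b, olt b a -> szlenk_iter eps A b x.
Proof.
move=> la; split=> [xa b ba|]; first exact: szlenk_iter_anti (oltW ba) _ xa.
elim: a la => [[]//|a _ [_ la]|J j0 f IH [f0 lf] h j].
  by case: (olt_irr (la a (ole_refl a))).
have fj : ole (f j) (OSup j0 f) by apply: ole_sup (ole_refl _).
have [jf|//] := ole_total (OSup j0 f) (f j); last exact: h.
apply: IH => [|b bf]; last by apply: h; exact: ole_trans bf fj.
split=> [|b bf]; first exact: ole_trans f0 jf.
by apply: ole_trans jf; apply: lf; exact: ole_trans bf fj.
Qed.

(* The class of all ordinals a such that the a-th derived set is nonempty. *)
Definition Sz_eps eps A : ord -> Prop := fun a => szlenk_iter eps A a !=set0.

Definition Sz A : ord -> Prop := fun a => exists2 eps, 0 < eps & Sz_eps eps A a.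

End derivation.

Definition Sz_op (E F : normedModType K) (T : operator E F) : ord -> Prop :=
  Sz [set adjoint T f | f in @dual_ball F].

(* T is an a-Szlenk operator: Sz(T) <= omega^a. *)
Definition Szlenk_operator (a : ord) (E F : normedModType K) (T : operator E F)
    : Prop :=
  oclass_le (Sz_op T) (oexp omega a).

End szlenk.

Section Linfty.
Context {R : realType} (k : scalars) {d} {Omega : measurableType d}.
Variable mu : {measure set Omega -> \bar R}.
Local Notation K := (scalar_field R k).
Implicit Types f g : Omega -> K.

Definition smeasurable f : Prop :=
  measurable_fun [set: Omega] (sre \o f) /\ measurable_fun [set: Omega] (sim \o f).

(* The essential supremum of |f|, and 0 when mu is the zero measure. *)
Definition Linf_norm f : \bar R := 'N[mu]_+oo [EFin \o (sabs \o f)].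

Definition Linf_pred : {pred Omega -> K} :=
  mem [set f | smeasurable f /\ (Linf_norm f < +oo)%E].

Lemma sabs_ge0 (x : K) : 0 <= sabs x.
Proof. by rewrite sabsE sqrtr_ge0. Qed.

Lemma smeasurable_sabs f : smeasurable f -> measurable_fun [set: Omega] (sabs \o f).
Proof.
case=> mr mi; rewrite (_ : _ \o _ =
    Num.sqrt \o ((fun w => (sre \o f) w ^+ 2) \+ (fun w => (sim \o f) w ^+ 2))).
  apply: measurableT_comp.
    by apply: continuous_measurable_fun; exact: sqrt_continuous.
  by apply: measurable_funD; exact: measurable_funX.
by apply/funext => w /=; rewrite sabsE.
Qed.

Lemma smeasurableD f g : smeasurable f -> smeasurable g -> smeasurable (f \+ g).
Proof.
move=> [fr fi] [gr gi]; split.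
  rewrite (_ : _ \o _ = (sre \o f) \+ (sre \o g)); first exact: measurable_funD.
  by apply/funext => w /=; rewrite sreD.
rewrite (_ : _ \o _ = (sim \o f) \+ (sim \o g)); first exact: measurable_funD.
by apply/funext => w /=; rewrite simD.
Qed.

Lemma smeasurableM f g : smeasurable f -> smeasurable g -> smeasurable (f \* g).
Proof.
move=> [fr fi] [gr gi]; split.
  rewrite (_ : _ \o _ = ((sre \o f) \* (sre \o g)) \- ((sim \o f) \* (sim \o g))).
    by apply: measurable_funB; exact: measurable_funM.
  by apply/funext => w /=; rewrite sreM.
rewrite (_ : _ \o _ = ((sre \o f) \* (sim \o g)) \+ ((sim \o f) \* (sre \o g))).
  by apply: measurable_funD; exact: measurable_funM.
by apply/funext => w /=; rewrite simM.
Qed.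

Lemma smeasurable_cst (a : K) : smeasurable (fun=> a).
Proof. by split; exact: measurable_cst. Qed.

Lemma smeasurable_indic (B : set Omega) : measurable B -> smeasurable (\1_B).
Proof.
move=> mB; split.
  rewrite (_ : _ \o _ = \1_B); first exact: measurable_indic.
  by apply/funext => w /=; rewrite !indicE; case: (w \in B); case: k.
rewrite (_ : _ \o _ = fun=> 0); first exact: measurable_cst.
by apply/funext => w /=; rewrite !indicE; case: (w \in B); case: k.
Qed.

Lemma sabsM (x y : K) : sabs (x * y) = sabs x * sabs y.
Proof.
have H : @sof R k (sabs (x * y)) = sof (sabs x * sabs y).
  by rewrite sofM !sof_sabs normrM.
by apply/eqP; rewrite eq_le -!(@le_sof R k) H lexx.
Qed.

Lemma ler_sabsD (x y : K) : sabs (x + y) <= sabs x + sabs y.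
Proof. by rewrite -(@le_sof R k) sofD !sof_sabs ler_normD. Qed.

Lemma Linf_norm_ge0 f : (0 <= Linf_norm f)%E.
Proof. exact: Lnorm_ge0. Qed.

Lemma le_Linf_norm f g : (\forall w \ae mu, sabs (f w) <= sabs (g w)) ->
  (Linf_norm f <= Linf_norm g)%E.
Proof.
move=> fg; rewrite /Linf_norm unlock /Lnorm; case: ifPn => // _.
apply: le_ess_sup; apply: filterS fg => w fg /=.
by rewrite lee_fin !ger0_norm ?sabs_ge0.
Qed.

Lemma Linf_normD f g : smeasurable f -> smeasurable g ->
  (Linf_norm (f \+ g)%R <= Linf_norm f + Linf_norm g)%E.
Proof.
move=> mf mg.
apply: le_trans (@eminkowski _ _ _ mu (sabs \o f) (sabs \o g) +oo%E _ _ _);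
  [|exact: smeasurable_sabs|exact: smeasurable_sabs|by rewrite leey].
rewrite /Linf_norm unlock /Lnorm; case: ifPn => // _.
apply: le_ess_sup; apply: nearW => w /=.
rewrite lee_fin !ger0_norm ?sabs_ge0 ?addr_ge0 ?sabs_ge0//.
exact: ler_sabsD.
Qed.

Lemma Linf_normZ (a : K) f : Linf_norm (a \*: f) = ((sabs a)%:E * Linf_norm f)%E.
Proof.
rewrite /Linf_norm unlock /Lnorm; case: ifPn => [mu0|_]; last by rewrite mule0.
rewrite -ess_supZl ?sabs_ge0//; congr ess_sup; apply/funext => w /=.
by rewrite -EFinM sabsM normrM [`|sabs a|]ger0_norm ?sabs_ge0.
Qed.

Lemma eq_Linf_norm f g : f = g %[ae mu] -> Linf_norm f = Linf_norm g.
Proof.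
move=> fg; apply/eqP; rewrite eq_le !le_Linf_norm//;
  by apply: filterS fg => w /(_ I) ->.
Qed.

Lemma Linf_norm_eq0 f : smeasurable f -> Linf_norm f = 0%E -> f = cst 0 %[ae mu].
Proof.
move=> mf f0.
have msf : measurable_fun [set: Omega] (EFin \o (sabs \o f)).
  by apply/measurable_EFinP; exact: smeasurable_sabs.
have := Lnorm_eq0_eq0 msf (ltry 0) f0.
apply: filterS => w + _ => /(_ I) [] h.
by apply/eqP; rewrite -normr_eq0 -sof_sabs h sof_eq0.
Qed.

Lemma Linf_submod_closed : submod_closed Linf_pred.
Proof.
split.
  rewrite inE; split; first exact: (smeasurable_cst 0).
  rewrite (_ : 0 = 0 \*: (fun=> 0 : K)); last first.
    by apply/funext => w /=; rewrite scale0r.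
  by rewrite Linf_normZ (_ : sabs 0 = 0) ?mul0e// sabsE; case: k;
     rewrite /= expr0n/= addr0 sqrtr0.
move=> a f g; rewrite !inE => -[mf lf] [mg lg].
have maf : smeasurable (a \*: f) by apply: (@smeasurableM (cst a)) => //; exact: smeasurable_cst.
split; first exact: smeasurableD.
apply: le_lt_trans (Linf_normD _ _) _ => //; rewrite lte_add_pinfty// Linf_normZ.
by rewrite lte_mul_pinfty// lee_fin sabs_ge0.
Qed.

HB.instance Definition _ := GRing.isSubmodClosed.Build K (Omega -> K) Linf_pred
  Linf_submod_closed.

Record Linf_fun := LinfFun { linf_fun :> Omega -> K; _ : linf_fun \in Linf_pred }.
HB.instance Definition _ := [isSub for linf_fun].
HB.instance Definition _ := [Choice of Linf_fun by <:].
HB.instance Definition _ := [SubChoice_isSubLmodule of Linf_fun by <:].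


Lemma linf_funP (f : Linf_fun) : smeasurable f /\ (Linf_norm f < +oo)%E.
Proof. by case: f => f /=; rewrite inE. Qed.

Definition Linf_eq (f g : Linf_fun) : bool := `[< (f : Omega -> K) = g %[ae mu] >].

Let Linf_eq_refl : reflexive Linf_eq.
Proof. by move=> f; apply/asboolP; exact: nearW. Qed.

Let Linf_eq_sym : symmetric Linf_eq.
Proof. by move=> f g; apply/idP/idP => /asboolP h; apply/asboolP/ae_eq_sym. Qed.

Let Linf_eq_trans : transitive Linf_eq.
Proof. by move=> g f h /asboolP fg /asboolP gh; apply/asboolP/(ae_eq_trans fg gh). Qed.

Canonical Linf_eq_canonical :=
  EquivRel Linf_eq Linf_eq_refl Linf_eq_sym Linf_eq_trans.

Local Open Scope quotient_scope.

(* The space L_oo(mu) of classes of essentially bounded measurable scalar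
   functions, modulo equality almost everywhere. *)
Definition Linfty : Type := {eq_quot Linf_eq}.
HB.instance Definition _ := Choice.on Linfty.
HB.instance Definition _ := EqQuotient.on Linfty.

Local Notation class := (\pi_Linfty).

Lemma Linfty_eqP (f g : Linf_fun) :
  class f = class g <-> (f : Omega -> K) = g %[ae mu].
Proof.
split=> [/eqP|h]; last by apply/eqP; rewrite eqmodE; apply/asboolP.
by rewrite eqmodE => /asboolP.
Qed.

Lemma Linfty_ind (P : Linfty -> Prop) : (forall f : Linf_fun, P (class f)) -> forall u, P u.
Proof. by move=> Pc u; rewrite -[u]reprK; exact: Pc. Qed.

Lemma Linfty_repr (f : Linf_fun) : (repr (class f) : Omega -> K) = f %[ae mu].
Proof. by apply/Linfty_eqP; rewrite reprK. Qed.

Definition Linfty_add (u v : Linfty) : Linfty := class (repr u + repr v).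
Definition Linfty_opp (u : Linfty) : Linfty := class (- repr u).
Definition Linfty_scale (a : K) (u : Linfty) : Linfty := class (a *: repr u).

Lemma Linfty_addE (f g : Linf_fun) : Linfty_add (class f) (class g) = class (f + g).
Proof.
apply/Linfty_eqP; apply: filterS2 (Linfty_repr f) (Linfty_repr g) => w hf hg wT.
by rewrite /= !fctE hf// hg.
Qed.

Lemma Linfty_oppE (f : Linf_fun) : Linfty_opp (class f) = class (- f).
Proof.
apply/Linfty_eqP; apply: filterS (Linfty_repr f) => w hf wT.
by rewrite /= !fctE hf.
Qed.

Lemma Linfty_scaleE (a : K) (f : Linf_fun) : Linfty_scale a (class f) = class (a *: f).
Proof.
apply/Linfty_eqP; apply: filterS (Linfty_repr f) => w hf wT.
by rewrite /= !fctE hf.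
Qed.

Let Linfty_addA : associative Linfty_add.
Proof.
move=> u v w; elim/Linfty_ind: u => f; elim/Linfty_ind: v => g; elim/Linfty_ind: w => h.
by rewrite !Linfty_addE addrA.
Qed.

Let Linfty_addC : commutative Linfty_add.
Proof. by move=> u v; elim/Linfty_ind: u => f; elim/Linfty_ind: v => g; rewrite !Linfty_addE addrC. Qed.

Let Linfty_add0 : left_id (class 0) Linfty_add.
Proof. by move=> u; elim/Linfty_ind: u => f; rewrite Linfty_addE add0r. Qed.

Let Linfty_addN : left_inverse (class 0) Linfty_opp Linfty_add.
Proof. by move=> u; elim/Linfty_ind: u => f; rewrite Linfty_oppE Linfty_addE addNr. Qed.

HB.instance Definition _ := GRing.isZmodule.Build Linfty
  Linfty_addA Linfty_addC Linfty_add0 Linfty_addN.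

Let Linfty_scaleA a b (u : Linfty) :
  Linfty_scale a (Linfty_scale b u) = Linfty_scale (a * b) u.
Proof. by elim/Linfty_ind: u => f; rewrite !Linfty_scaleE scalerA. Qed.

Let Linfty_scale1 : left_id 1 Linfty_scale.
Proof. by move=> u; elim/Linfty_ind: u => f; rewrite Linfty_scaleE scale1r. Qed.

Let Linfty_scaleDr : right_distributive Linfty_scale +%R.
Proof.
move=> a u v; elim/Linfty_ind: u => f; elim/Linfty_ind: v => g.
by rewrite /GRing.add/= Linfty_addE !Linfty_scaleE Linfty_addE scalerDr.
Qed.

Let Linfty_scaleDl (u : Linfty) : {morph Linfty_scale^~ u : a b / a + b}.
Proof.
elim/Linfty_ind: u => f a b.
by rewrite /GRing.add/= !Linfty_scaleE Linfty_addE scalerDl.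
Qed.

HB.instance Definition _ := GRing.Zmodule_isLmodule.Build K Linfty
  Linfty_scaleA Linfty_scale1 Linfty_scaleDr Linfty_scaleDl.

Definition Linfty_norm (u : Linfty) : K := sof (fine (Linf_norm (repr u))).

Lemma Linfty_normE (f : Linf_fun) : Linfty_norm (class f) = sof (fine (Linf_norm f)).
Proof. by rewrite /Linfty_norm (eq_Linf_norm (Linfty_repr f)). Qed.

Lemma Linf_norm_fin (f : Linf_fun) : Linf_norm f \is a fin_num.
Proof. by rewrite ge0_fin_numE ?Linf_norm_ge0//; case: (linf_funP f). Qed.

Let Linfty_normD (u v : Linfty) : Linfty_norm (u + v) <= Linfty_norm u + Linfty_norm v.
Proof.
elim/Linfty_ind: u => f; elim/Linfty_ind: v => g.
rewrite [class f + class g]Linfty_addE !Linfty_normE -sofD le_sof -lee_fin.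
rewrite EFinD !fineK ?Linf_norm_fin//.
by apply: Linf_normD; case: (linf_funP f); case: (linf_funP g).
Qed.

Let Linfty_normZ (a : K) (u : Linfty) : Linfty_norm (a *: u) = `|a| * Linfty_norm u.
Proof.
elim/Linfty_ind: u => f; rewrite [a *: class f]Linfty_scaleE !Linfty_normE -sof_sabs -sofM.
by congr sof; rewrite (Linf_normZ a f) fineM ?Linf_norm_fin.
Qed.

Let Linfty_norm0_eq0 (u : Linfty) : Linfty_norm u = 0 -> u = 0.
Proof.
elim/Linfty_ind: u => f; rewrite Linfty_normE => /eqP; rewrite sof_eq0 => /eqP f0.
have {}f0 : Linf_norm f = 0%E by rewrite -[LHS]fineK ?Linf_norm_fin// f0.
by apply/Linfty_eqP; apply: Linf_norm_eq0 f0; case: (linf_funP f).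
Qed.

HB.instance Definition _ := Lmodule_isNormed.Build K Linfty
  Linfty_normD Linfty_normZ Linfty_norm0_eq0.

(* The multiplication by the characteristic function of B. *)
Section mul_indic.
Variables (B : set Omega) (mB : measurable B).

Lemma Linf_mul_indic_subproof (f : Linf_fun) : (f \* \1_B : Omega -> K) \in Linf_pred.
Proof.
have [mf lf] := linf_funP f; rewrite inE; split.
  by apply: smeasurableM => //; exact: smeasurable_indic.
apply: le_lt_trans lf; apply: le_Linf_norm; apply: nearW => w /=.
rewrite indicE sabsM; case: (w \in B) => /=.
  by rewrite -(le_sof k) sofM !sof_sabs normr1 mulr1.
by rewrite -(le_sof k) sofM !sof_sabs normr0 mulr0.
Qed.

Definition Linfty_mul_indic (u : Linfty) : Linfty :=
  class (LinfFun (Linf_mul_indic_subproof (repr u))).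

Lemma Linfty_mul_indicE (f : Linf_fun) :
  Linfty_mul_indic (class f) = class (LinfFun (Linf_mul_indic_subproof f)).
Proof.
apply/Linfty_eqP; apply: filterS (Linfty_repr f) => w hf wT.
by rewrite /= hf.
Qed.

End mul_indic.

End Linfty.

Definition Asplund (R : realType) (k : scalars)
    (E F : normedModType (scalar_field R k)) (T : operator E F) : Prop :=
  forall (d : measure_display) (Omega : measurableType d)
         (mu : {finite_measure set Omega -> \bar R})
         (S : operator F (Linfty k mu)) (eps : R), 0 < eps ->
  exists (B : set Omega) (mB : measurable B),
    (mu setT - eps%:E < mu B)%E /\
    precompact [set Linfty_mul_indic mB f
               | f in [set S (T x) | x in closed_unit_ball E]].

(* Main.v *)
(* Both conditions say that T*B_{F*} is fragmented: every nonempty subset has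
   nonempty relatively weak*-open pieces of arbitrarily small norm diameter.
   For the Szlenk index, a set without small pieces survives all derivations,
   and otherwise the derivations decrease strictly until they reach the empty
   set.

   If T*B_{F*} is fragmented and S : F -> L_oo(mu), then every ultrafilter U
   finer than the conull filter yields a functional f_U : y |-> lim_U S y.  A
   small weak*-open piece of {T* f_U : A in U} provides a nonnull subset of A
   on which each STe, e in B_E, is nearly constant.  Exhausting the space by
   such sets gives total boundedness off a set of small measure.

   If T*B_{F*} has a nonempty subset A without small pieces, there is a dyadic
   tree of weak*-open sets V_s meeting A, whose siblings are separated by some
   e_s in B_E.  Choose functionals f_s in B_{F*} with T* f_s in V_s, and let
   S y be a weak limit, along an ultrafilter on n, of the functions
   x |-> f_{x_1...x_n}(y) of the binary digits of x in [0, 1[; it exists by the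
   Radon-Nikodym theorem.  The functions STe_s then oscillate on every set of
   positive measure, so no such set makes ST(B_E) relatively compact. *)
Require Import Defs.
From HB Require Import structures.
From mathcomp Require Import finmap.
From mathcomp Require Import all_boot all_order all_algebra.
From mathcomp Require Import all_classical all_reals all_analysis.
From mathcomp Require Import measurable_realfun ess_sup_inf.
From mathcomp.real_closed Require Import complex.
From mathcomp Require Import ring lra.

Set Implicit Arguments.
Unset Strict Implicit.
Unset Printing Implicit Defensive.

Import Order.TTheory GRing.Theory Num.Theory.
Import numFieldNormedType.Exports.

Local Open Scope classical_set_scope.
Local Open Scope ring_scope.

(** * Szlenk index and fragmentability *)

Section ordinals.
Implicit Types a b c : ord.

Lemma oadd_le a b c : ole b c -> ole (oadd a b) (oadd a c).
Proof.
elim: b c => [c _|b IH c|I i0 f IH c] /=.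
- by elim: c => [|c /= h|J j0 g h] /=;
    [exact: ole_refl|exact: ole_succ|apply: ole_sup (h j0)].
- elim: c => [//|c _ /= h|J j0 g IHc [j h] /=]; first exact: IH.
  by exists j; exact: IHc.
- by move=> h i; exact: IH.
Qed.

(** [omul a (OSucc OZero)] unfolds to [oadd OZero a], not to [a]; this inequality bridges the
    two. *)
Lemma ole_oadd0 a : ole a (oadd OZero a).
Proof.
elim: a => [//|a IH|I i0 f IH] //= i.
exact: ole_sup (IH i).
Qed.

Lemma oexp_omega_gt0 a : olt OZero (oexp omega a).
Proof.
elim: a => [//|a IH|I i0 f IH] /=; last by exists i0; exact: IH.
by exists 1%N; apply: (ole_trans IH); exact: ole_oadd0.
Qed.

(** By definition omega^(a+1) is the supremum of the omega^a * n, and omega^a < omega^a * 2 because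
    omega^a is positive. *)
Lemma oexp_omega_lt a b : ole b (oexp omega a) -> olt b (oexp omega (OSucc a)).
Proof.
move=> ba; suff h : olt b (oadd (oadd OZero (oexp omega a)) (oexp omega a)).
  by exists 2%N.
apply: (ole_trans (b := OSucc (oadd OZero (oexp omega a)))).
  exact: (ole_trans ba (ole_oadd0 _)).
exact: (oadd_le (oadd OZero (oexp omega a)) (oexp_omega_gt0 a)).
Qed.

(** Any ordinal bound on the index can thus be weakened to a power of omega. *)
Lemma ole_oexp_omega a : ole a (oexp omega a).
Proof.
elim: a => [//|a IH|I i0 f IH] /=; first exact: oexp_omega_lt.
by move=> i; exact: ole_sup (IH i).
Qed.

End ordinals.

Section fragmentability.
Context {R : realType} {k : scalars} {E : normedModType (scalar_field R k)}.
Implicit Types (A B K : set (wstar_dual E)) (eps : R) (a b : ord).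

Definition fragmented K := forall eps A, 0 < eps -> A `<=` K -> A !=set0 ->
  exists V : set (wstar_dual E),
    [/\ open V, A `&` V !=set0 & (dual_diam (A `&` V) <= eps%:E)%E].

(** A piece of diameter at most eps removes its points from the derived set, and a set without such
    pieces loses no point. Fragmentability therefore means that no nonempty subset of [K] is fixed
    by a derivation. *)
Lemma fragmentedP K : fragmented K <->
  forall eps A, 0 < eps -> A `<=` K -> A `<=` szlenk_deriv eps A -> A = set0.
Proof.
split=> [frag eps A e0 AK AA|H eps A e0 AK A0].
  apply/seteqP; split=> // x Ax.
  have [|V [oV [y [Ay Vy]]]] := frag _ _ e0 AK; first by exists x.
  by rewrite leNgt => /negP[]; have [_] := AA _ Ay; exact.
apply: contrapT => hV; move: A0; rewrite (H eps A e0 AK) => [[]//|x Ax].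
split=> // V oV Vx; rewrite ltNge; apply/negP => dV; apply: hV.
by exists V; split=> //; exists x.
Qed.

Lemma szlenk_iter_fixed eps K A a :
  A `<=` K -> A `<=` szlenk_deriv eps A -> A `<=` szlenk_iter eps K a.
Proof.
move=> AK AA; elim: a => [//|a IH|I i0 f IH] /= x Ax; last by move=> i; exact: IH.
exact: szlenk_derivS IH _ (AA _ Ax).
Qed.

(* If no nonempty iterate is fixed, the iterates are strictly decreasing while
   they are nonempty, and the rank of reverse strict inclusion among them
   bounds their indices. *)
Lemma Sz_eps_bounded eps K : 0 < eps -> fragmented K ->
  exists a, forall b, Sz_eps eps K b -> ole b a.
Proof.
move=> e0 /fragmentedP frag.
pose it := szlenk_iter eps K.
pose lt A B := exists c, it c = A /\ A !=set0 /\ B `<=` A /\ B <> A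
  /\ exists c', it c' = B.
have wf : well_founded lt.
  (* The iterates decrease, so a strictly larger iterate has a strictly smaller index, and [olt_wf]
     applies. *)
  have acc c : Acc lt (it c).
    elim/(well_founded_ind olt_wf): c => c IH; constructor=> B.
    move=> [c' [<- [_ [sub [ne _]]]]]; apply: IH.
    have [/(@szlenk_iter_anti _ _ _ eps K)|//] := ole_total c c'.
    by move=> sub'; case: ne; apply/seteqP; split.
  move=> A; constructor=> B [c [<- _]]; exact: acc.
have [rk rkP] := ord_rank wf.
(* Suppose the rank c of [it b] were below b. Then [it b] lies in the derivative of [it c] and
   differs from [it c] by fragmentability. So [it c] precedes [it b], and its rank, at least c by
   induction, would be below c. *)
have rk_ge b : it b !=set0 -> ole b (rk (it b)).
  elim/(well_founded_ind olt_wf): b => b IH b0.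
  have [//|h] := ole_total b (rk (it b)).
  have bsub : it b `<=` it (OSucc (rk (it b))) by exact: szlenk_iter_anti.
  have c0 : it (rk (it b)) !=set0.
    by case: b0 => x /bsub [hx _]; exists x.
  case: (olt_irr (a := rk (it b))); apply/rkP.
  exists (it (rk (it b))); last exact: IH.
  exists (rk (it b)); split=> //; split=> //; split.
    by apply: subset_trans bsub _; exact: szlenk_deriv_sub.
  split; last by exists b.
  move=> eqb; case: c0 => x; rewrite -{1}/(it _).
  have sub0 : it b `<=` K by exact: (@szlenk_iter_anti _ _ _ eps K OZero b).
  by rewrite -eqb (frag eps (it b) e0 sub0)//; rewrite {2}eqb.
exists (OSup (set0 : set (wstar_dual E)) rk) => b /rk_ge h.
exact: ole_sup h.
Qed.

(** A nonempty set fixed by a derivation would survive up to the index omega^a itself, while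
    surviving indices must stay strictly below it. Conversely, the bounds for the various eps have a
    common supremum. *)
Lemma Sz_fragmented K :
  (exists a, oclass_le (Sz K) (oexp omega a)) <-> fragmented K.
Proof.
split=> [[a Ka]|frag].
  apply/fragmentedP => eps A e0 AK AA; apply/seteqP; split=> // x Ax.
  apply: (olt_irr (a := oexp omega a)); apply: Ka; exists eps => //.
  by exists x; exact: szlenk_iter_fixed Ax.
have /choice[al alP] (eps : R) : exists a, 0 < eps -> forall b, Sz_eps eps K b -> ole b a.
  (* [OZero] is a default for eps <= 0, where nothing is claimed. *)
  have [e0|e0] := ltP 0 eps; last by exists OZero.
  by have [a h] := Sz_eps_bounded e0 frag; exists a.
(* The successor turns b <= sup al <= omega^(sup al) into the strict inequality that [oclass_le]
   demands. *)
exists (OSucc (OSup 0 al)) => b [eps e0 /(alP _ e0) h].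
apply: oexp_omega_lt; apply: (ole_trans _ (ole_oexp_omega _)).
exact: ole_sup h.
Qed.

End fragmentability.

(** * Scalars, bounded operators and limits along ultrafilters *)

Section scalars.
Context {R : realType} {k : scalars}.
Local Notation K := (scalar_field R k).
Implicit Types (x y : K) (a b : R).

Lemma scalar_ext x y : sre x = sre y -> sim x = sim y -> x = y.
Proof. by case: k x y => [x y|[a b] [c d]] //= -> ->. Qed.

(* For real scalars [b] is ignored. *)
Definition smk a b : K :=
  match k return scalar_field R k with
  | RealScalars => a
  | ComplexScalars => (a +i* b)%C
  end.

Lemma sre_smk a b : sre (smk a b) = a.
Proof. by rewrite /smk; case: k. Qed.

Lemma sim_smk a b : (k = RealScalars -> b = 0) -> sim (smk a b) = b.
Proof. by rewrite /smk; case: k => //= ->. Qed.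

Lemma sim_real x : k = RealScalars -> sim x = 0.
Proof. by move: x; case: k. Qed.

Lemma sreN x : sre (- x) = - sre x.
Proof. by case: k x => // -[]. Qed.

Lemma simN x : sim (- x) = - sim x.
Proof. by case: k x => [x|[]] //=; rewrite oppr0. Qed.

Lemma sreB x y : sre (x - y) = sre x - sre y.
Proof. by rewrite sreD sreN. Qed.

Lemma simB x y : sim (x - y) = sim x - sim y.
Proof. by rewrite simD simN. Qed.

Lemma sre_sof a : sre (sof a : K) = a.
Proof. by case: k. Qed.

Lemma sim_sof a : sim (sof a : K) = 0.
Proof. by case: k. Qed.

Lemma sof0 : (sof 0 : K) = 0.
Proof. by apply/eqP; rewrite sof_eq0. Qed.

Lemma sof1 : (sof 1 : K) = 1.
Proof. by case: k. Qed.

Lemma sof_sre x : 0 <= x -> sof (sre x) = x.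
Proof. by case: k x => // -[a b] /=; rewrite lecE/= => /andP[/eqP ->]. Qed.

Lemma lt_sof a b : ((sof a : K) < sof b) = (a < b).
Proof.
rewrite !lt_def le_sof; case: k => //=.
by rewrite (inj_eq (@complexI _)).
Qed.

Lemma sabs_sof a : 0 <= a -> sabs (sof a : K) = a.
Proof. by move=> a0; rewrite sabsE sre_sof sim_sof expr0n/= addr0 sqrtr_sqr ger0_norm. Qed.

Lemma sabs0 : sabs (0 : K) = 0.
Proof. by rewrite -sof0 sabs_sof. Qed.

Lemma sabsN x : sabs (- x) = sabs x.
Proof. by rewrite /sabs normrN. Qed.

Lemma sabsC x y : sabs (x - y) = sabs (y - x).
Proof. by rewrite -sabsN opprB. Qed.

Lemma sabs_dist y x z : sabs (x - z) <= sabs (x - y) + sabs (y - z).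
Proof. by rewrite (le_trans _ (ler_sabsD _ _))// addrA subrK. Qed.

Lemma le_sre_sabs x : `|sre x| <= sabs x.
Proof.
by rewrite sabsE -(ler_pXn2r (n := 2)) ?nnegrE ?sqrtr_ge0// real_normK ?num_real//
  sqr_sqrtr ?addr_ge0 ?sqr_ge0// lerDl sqr_ge0.
Qed.

Lemma le_sim_sabs x : `|sim x| <= sabs x.
Proof.
by rewrite sabsE -(ler_pXn2r (n := 2)) ?nnegrE ?sqrtr_ge0// real_normK ?num_real//
  sqr_sqrtr ?addr_ge0 ?sqr_ge0// lerDr sqr_ge0.
Qed.

Lemma sabs_le_reim x : sabs x <= `|sre x| + `|sim x|.
Proof.
rewrite sabsE -(ler_pXn2r (n := 2)) ?nnegrE ?sqrtr_ge0 ?addr_ge0//.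
rewrite sqr_sqrtr ?addr_ge0 ?sqr_ge0// sqrrD !real_normK ?num_real//.
by rewrite lerD2r lerDl mulrn_wge0// mulr_ge0.
Qed.

End scalars.

Section bounded_operators.
Context {R : realType} {k : scalars}.
Local Notation K := (scalar_field R k).
Implicit Types E F : normedModType K.

Lemma sof_norm E (x : E) : sof (sre `|x|) = `|x|.
Proof. exact: sof_sre. Qed.

Lemma operator_bound E F (T : operator E F) :
  exists2 M : R, 0 < M & forall x, `|T x| <= sof M * `|x|.
Proof.
have /linear_boundedP/pinfty_ex_gt0[r r0 hr] := operator_bounded T.
exists (sre r); first by rewrite -(@lt_sof R k) sof_sre ?sof0// ltW.
by rewrite sof_sre// ltW.
Qed.

Lemma exists_operator E F (f : E -> F) (M : R) : linear f ->
  (forall x, `|f x| <= sof M * `|x|) -> exists T : operator E F, T =1 f.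
Proof.
move=> lf hM; pose g : {linear E -> F} := HB.pack f (GRing.isLinear.Build _ _ _ _ f lf).
suff bg : bounded_near g (nbhs (0 : E)) by exists (Operator bg).
apply/bounded_funP => r; exists (sof `|M| * r) => x xr.
have M0 : (0 : K) <= sof `|M| by rewrite -sof0 le_sof.
apply: le_trans (hM x) _; apply: (@le_trans _ _ (sof `|M| * `|x|)).
  by rewrite ler_wpM2r// le_sof ler_norm.
by rewrite ler_wpM2l.
Qed.

Lemma functional_norm_leP E (f : E -> K) (C : R) : (functional_norm f <= C%:E)%E <->
  forall x, `|x| <= 1 -> sabs (f x) <= C.
Proof.
split=> [h x x1|h].
  by rewrite -lee_fin (le_trans _ h)//; apply: ereal_sup_ubound; exists x.
by apply: ge_ereal_sup => _ [x x1 <-]; rewrite lee_fin h.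
Qed.

Lemma dual_diam_leP E (A : set (wstar_dual E)) (C : R) : (dual_diam A <= C%:E)%E <->
  forall f g, A f -> A g -> forall x : E, `|x| <= 1 ->
    sabs ((f : dual E) x - (g : dual E) x) <= C.
Proof.
split=> [h f g Af Ag x x1|h].
  pose fg (y : E) : K := (f : dual E) y - (g : dual E) y.
  have : (functional_norm fg <= C%:E)%E.
    by rewrite (le_trans _ h)//; apply: ereal_sup_ubound; exists (f, g).
  by move=> /functional_norm_leP/(_ x x1).
apply: ge_ereal_sup => _ [[f g] [/= Af Ag] <-]; apply/functional_norm_leP => x x1.
exact: h.
Qed.

End bounded_operators.

Section ultralimits.
Context {R : realType} {T : Type} (F : set_system T) {UF : UltraFilter F}.

Lemma ultra_map (U : Type) (f : T -> U) : UltraFilter (f @ F).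
Proof.
split; first exact: fmap_proper_filter.
move=> G PG FG; apply/seteqP; split=> // A GA.
have [//|nA] := in_ultra_setVsetC (f @^-1` A) UF.
by have /filter_ex[x []] : G (A `&` ~` A) by apply: filterI => //; exact: FG.
Qed.

(** The image ultrafilter contains the compact interval [-M, M]. *)
Lemma ultra_cvg (g : T -> R) M :
  (\forall x \near F, `|g x| <= M) -> g x @[x --> F] --> lim (g x @[x --> F]).
Proof.
move=> gM; have := @segment_compact R (- M) M.
rewrite compact_ultra => /(_ _ (ultra_map g)) [|l [_ gl]].
  by apply: filterS gM => x /=; rewrite in_itv/= -ler_norml.
by apply/cvg_ex; exists l.
Qed.

Context {k : scalars}.
Local Notation K := (scalar_field R k).
Implicit Types g h : T -> K.

Definition slim g : K := smk (lim (sre (g x) @[x --> F])) (lim (sim (g x) @[x --> F])).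

(** The bound is asked only on a member of [F], since elements of L_oo are bounded only almost
    everywhere. *)
Definition sbounded g := exists M, \forall x \near F, sabs (g x) <= M.

Lemma sre_slim g : sbounded g -> sre (g x) @[x --> F] --> sre (slim g).
Proof.
move=> [M hM]; rewrite sre_smk; apply: (@ultra_cvg _ M).
by apply: filterS hM => x; exact/le_trans/le_sre_sabs.
Qed.

Lemma sim_slim g : sbounded g -> sim (g x) @[x --> F] --> sim (slim g).
Proof.
move=> [M hM]; rewrite sim_smk; last first.
  move=> k0; rewrite (_ : (fun x => _) = fun=> 0) ?lim_cst//.
  by apply/funext => x; rewrite sim_real.
apply: (@ultra_cvg _ M).
by apply: filterS hM => x; exact/le_trans/le_sim_sabs.
Qed.

Lemma sabs_slim g c : sbounded g -> sabs (g x - c) @[x --> F] --> sabs (slim g - c).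
Proof.
move=> bg; under eq_fun do rewrite sabsE sreB simB; rewrite sabsE sreB simB.
have cB (u : T -> R) l d : u x @[x --> F] --> l -> (u x - d) ^+ 2 @[x --> F] --> (l - d) ^+ 2.
  move=> ul; rewrite expr2; under eq_fun do rewrite expr2.
  by apply: cvgM; apply: cvgB => //; exact: cvg_cst.
apply: (@continuous_cvg _ _ _ _ _ _ Num.sqrt); first exact: sqrt_continuous.
by apply: cvgD; apply: cB; [exact: sre_slim|exact: sim_slim].
Qed.

Lemma slim_dist_le g c (r : R) : sbounded g ->
  (\forall x \near F, sabs (g x - c) <= r) -> sabs (slim g - c) <= r.
Proof. by move=> bg; apply: cvgr_to_le; exact: sabs_slim. Qed.

Lemma slim_dist_lt g c (r : R) : sbounded g ->
  sabs (slim g - c) < r -> \forall x \near F, sabs (g x - c) < r.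
Proof. by move=> bg lr; apply: (cvgr_lt (sabs (slim g - c))) => //; exact: sabs_slim. Qed.

(** The relation is asked only on a member of [F], because representatives of classes in L_oo
    satisfy it only almost everywhere. *)
Lemma slim_linear a f g h : sbounded g -> sbounded h ->
  (\forall x \near F, f x = a * g x + h x) -> slim f = a * slim g + slim h.
Proof.
move=> bg bh fgh; have [M gM] := bg; have [N hN] := bh.
have bf : sbounded f.
  exists (sabs a * M + N); apply: filterS3 fgh gM hN => x -> gx hx.
  by rewrite (le_trans (ler_sabsD _ _))// lerD// sabsM ler_wpM2l ?sabs_ge0.
apply: scalar_ext.
  apply: (cvg_unique _ (sre_slim bf)); first exact: norm_hausdorff.
  have -> : sre (a * slim g + slim h) =
    sre a * sre (slim g) - sim a * sim (slim g) + sre (slim h) by rewrite sreD sreM.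
  apply: cvg_trans (_ : (fun x => sre a * sre (g x) - sim a * sim (g x) + sre (h x)) x
    @[x --> F] --> _).
    by apply: near_eq_cvg; apply: filterS fgh => x ->; rewrite sreD sreM.
  apply: cvgD; last exact: sre_slim.
  by apply: cvgB; apply: cvgMr; [exact: sre_slim|exact: sim_slim].
apply: (cvg_unique _ (sim_slim bf)); first exact: norm_hausdorff.
have -> : sim (a * slim g + slim h) =
  sre a * sim (slim g) + sim a * sre (slim g) + sim (slim h) by rewrite simD simM.
apply: cvg_trans (_ : (fun x => sre a * sim (g x) + sim a * sre (g x) + sim (h x)) x
  @[x --> F] --> _).
  by apply: near_eq_cvg; apply: filterS fgh => x ->; rewrite simD simM.
apply: cvgD; last exact: sim_slim.
by apply: cvgD; apply: cvgMr; [exact: sim_slim|exact: sre_slim].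
Qed.

End ultralimits.

Lemma ultra_finite_cover {T : Type} (F : set_system T) {UF : UltraFilter F}
  (I : finType) (A : I -> set T) :
  (\forall x \near F, exists i, A i x) -> exists i, F (A i).
Proof.
move=> FA; apply: contrapT => nA.
have nF : \forall x \near F, forall i, ~ A i x.
  apply: filter_forall => i; have [Ai|//] := in_ultra_setVsetC (A i) UF.
  by case: nA; exists i.
have FAn : F ([set x | exists i, A i x] `&` [set x | forall i, ~ A i x]).
  exact: filterI.
by have /filter_ex[x [[i Aix] /(_ i)]] := FAn.
Qed.

Lemma exists_ultra_oo : exists U : set_system nat, UltraFilter U /\ \oo `<=` U.
Proof. exact: ultraFilterLemma. Qed.

(** * Total boundedness in L_oo *)

Section Linfty_norm.
Context {R : realType} {k : scalars} {d} {Omega : measurableType d}.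
Variable mu : {measure set Omega -> \bar R}.
Local Notation K := (scalar_field R k).
Implicit Types (u v : Linfty k mu) (C : R).

Lemma Linf_norm_leP (f : Omega -> K) C : 0 <= C ->
  (Linf_norm mu f <= C%:E)%E <-> \forall w \ae mu, sabs (f w) <= C.
Proof.
move=> C0; rewrite /Linf_norm unlock /Lnorm; case: ifPn => mu0.
  split=> [/ess_supP|h].
    by apply: filterS => w /=; rewrite ger0_norm ?sabs_ge0.
  by apply/ess_supP; apply: filterS h => w /=; rewrite ger0_norm ?sabs_ge0.
(* For the null measure the norm is 0 and every property holds almost everywhere. *)
split=> [_|]; last by rewrite lee_fin.
apply: measure0_ae; apply/eqP; rewrite eq_le measure_ge0 andbT.
by rewrite leNgt.
Qed.

Lemma Linfty_norm_leP u C : 0 <= C ->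
  `|u| <= sof C <-> \forall w \ae mu, sabs (repr u w) <= C.
Proof.
move=> C0; rewrite -Linf_norm_leP// [ `|u|]/(Linfty_norm u) /Linfty_norm le_sof.
by rewrite -lee_fin fineK ?Linf_norm_fin.
Qed.

Lemma Linfty_repr_linear (a : K) u v :
  \forall w \ae mu, repr (a *: u + v) w = a * repr u w + repr v w.
Proof.
have h1 := Linfty_repr (a *: repr u + repr v).
have -> : a *: u + v = \pi_(Linfty k mu)%qT (a *: repr u + repr v).
  by rewrite -Linfty_addE -Linfty_scaleE !reprK.
by apply: filterS h1 => w /(_ I) ->.
Qed.

Lemma Linfty_reprB u v : \forall w \ae mu, repr (u - v) w = repr u w - repr v w.
Proof.
rewrite addrC -scaleN1r; apply: filterS (Linfty_repr_linear (-1) v u) => w ->.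
by rewrite mulN1r addrC.
Qed.

Lemma Linfty_distP u v C : 0 <= C ->
  `|u - v| <= sof C <-> \forall w \ae mu, sabs (repr u w - repr v w) <= C.
Proof.
move=> C0; rewrite Linfty_norm_leP//; split; apply: filterS2 (Linfty_reprB u v) => w.
  by move=> ->.
by move=> ->.
Qed.

Lemma exists_Linfty (f : Omega -> K) C : smeasurable f ->
  (\forall w \ae mu, sabs (f w) <= C) -> exists u, repr u = f %[ae mu].
Proof.
move=> mf fC; have pf : f \in Linf_pred mu.
  rewrite inE; split=> //; apply: (@le_lt_trans _ _ (`|C|%:E)); last exact: ltry.
  apply/Linf_norm_leP => //; apply: filterS fC => w /le_trans; apply.
  exact: ler_norm.
by exists (\pi_(Linfty k mu)%qT (LinfFun pf)); exact: (Linfty_repr (LinfFun pf)).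
Qed.

Lemma smeasurable_repr u : smeasurable (repr u).
Proof. by case: (linf_funP (repr u)). Qed.

(** Off one null set all the countably many Cauchy estimates hold pointwise. The limit is taken
    pointwise along an ultrafilter finer than [\oo] and inherits the rate [c]. *)
Lemma Linfty_complete (u : nat -> Linfty k mu) (c : nat -> R) :
  (forall n, 0 <= c n) -> c n @[n --> \oo] --> 0 ->
  (forall n m, (n <= m)%N -> `|u m - u n| <= sof (c n)) ->
  exists l, forall n, `|u n - l| <= sof (c n).
Proof.
move=> c0 cc uc; have [U [UU oU]] := exists_ultra_oo.
have : forall n, \forall w \ae mu,
    forall m, (n <= m)%N -> sabs (repr (u m) w - repr (u n) w) <= c n.
  move=> n; apply/ae_foralln => m; have [nm|_] := leqP n m; last exact: nearW.
  by have /(Linfty_distP _ _ (c0 n)) := uc n m nm; apply: filterS => w h _.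
move=> /ae_foralln[N [mN N0 subN]].
(* Zeroing a null set makes the sequence Cauchy everywhere, so that its
   pointwise limit is measurable. *)
pose f n := (repr (u n) : Omega -> K) \* \1_(~` N).
have mf n : smeasurable (f n).
  apply: smeasurableM; first exact: smeasurable_repr.
  exact: smeasurable_indic (measurableC mN).
have fE n w : ~ N w -> f n w = repr (u n) w.
  by move=> Nw; rewrite /f/= indicE mem_set ?mulr1.
have f0 n w : N w -> f n w = 0.
  by move=> Nw; rewrite /f/= indicE memNset ?mulr0//; apply.
have fc n m w : (n <= m)%N -> sabs (f m w - f n w) <= c n.
  move=> nm; have [Nw|Nw] := pselect (N w); first by rewrite !f0// subr0 sabs0.
  rewrite !fE//; apply: contrapT => h; apply: Nw; apply: subN => /(_ n m nm).
  exact: h.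
have bf w : sbounded (U) (f ^~ w).
  exists (c 0%N + sabs (f 0%N w)); apply: nearW => n.
  have := ler_sabsD (f n w - f 0%N w) (f 0%N w); rewrite subrK => /le_trans; apply.
  by rewrite lerD2r fc.
pose g w := slim U (f ^~ w).
have gc n w : sabs (f n w - g w) <= c n.
  rewrite sabsC; apply: slim_dist_le => //; apply: oU; exists n => // m /= nm.
  exact: fc.
have mg : smeasurable g.
  split.
    apply: (@measurable_fun_cvg _ _ _ _ (fun n w => sre (f n w))) => [n|w _].
      by case: (mf n).
    apply/cvgrPdist_le => e e0; near=> n.
    rewrite -sreB (le_trans (le_sre_sabs _))// sabsC (le_trans (gc _ _))//.
    by near: n; apply: (cvgr_le 0).
  apply: (@measurable_fun_cvg _ _ _ _ (fun n w => sim (f n w))) => [n|w _].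
    by case: (mf n).
  apply/cvgrPdist_le => e e0; near=> n.
  rewrite -simB (le_trans (le_sim_sabs _))// sabsC (le_trans (gc _ _))//.
  by near: n; apply: (cvgr_le 0).
have nN : \forall w \ae mu, ~ N w.
  by exists N; split=> // w /=; exact: contrapT.
have [C C0 /(Linfty_norm_leP _ C0) uC] : exists2 C, 0 <= C & `|u 0%N| <= sof C.
  exists (sre `|u 0%N|); last by rewrite sof_norm.
  by rewrite -(@le_sof R k) sof_norm sof0.
have [l lg] : exists l : Linfty k mu, (repr l : Omega -> K) = g %[ae mu].
  apply: (@exists_Linfty g (c 0%N + C)) => //.
  apply: filterS2 nN uC => w Nw uw.
  have := ler_sabsD (g w - f 0%N w) (f 0%N w); rewrite subrK => /le_trans; apply.
  by rewrite lerD ?fE// sabsC -fE.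
exists l => n; apply/Linfty_distP => //.
by apply: filterS2 nN lg => w Nw /(_ Logic.I) ->; rewrite -fE.
Unshelve. all: by end_near. Qed.

(** An ultrafilter on the closure contains sets of arbitrarily small diameter. Points chosen in them
    form a Cauchy sequence, whose limit is the limit of the ultrafilter. The centres [L i] may be
    arbitrary functions, as they only serve to compare members of [A]. *)
Lemma totally_bounded_precompact (A : set (Linfty k mu)) :
  (forall e, 0 < e -> exists (I : finType) (L : I -> Omega -> K), forall u, A u ->
    exists i, \forall w \ae mu, sabs (repr u w - L i w) <= e) ->
  precompact A.
Proof.
move=> tbA; rewrite precompactE compact_ultra => F UF FA.
have ballE (u : Linfty k mu) (e : R) : 0 < e -> nbhs u [set v | `|u - v| <= sof e].
  move=> e0; apply/nbhs_ballP; exists (sof e); first by rewrite /= -sof0 lt_sof.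
  by move=> v; rewrite -ball_normE /ball_ /= => /ltW.
have small e : 0 < e -> exists2 B, F B & forall u v, B u -> B v -> `|u - v| <= sof e.
  (* A point of the closure is within e / 4 of a member of [A], itself within e / 4 of some [L i];
     two points with the same [L i] are then within e of each other. *)
  move=> e0; have e40 : 0 < e / 4 by rewrite divr_gt0.
  have [I [L hL]] := tbA _ e40.
  pose B i := [set u : Linfty k mu | \forall w \ae mu, sabs (repr u w - L i w) <= e / 2].
  have [|i FB] := @ultra_finite_cover _ F _ I B.
    apply: filterS FA => u /(_ _ (ballE u _ e40))[v [/hL[i hi]]] /=.
    move=> /(Linfty_distP _ _ (ltW e40)) uv; exists i.
    apply: filterS2 hi uv => w hi uv.
    by rewrite (le_trans (sabs_dist (repr v w) _ _))//; lra.
  exists (B i) => // u v Bu Bv; apply/Linfty_distP; first exact: ltW.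
  apply: filterS2 Bu Bv => w hu hv.
  by rewrite (le_trans (sabs_dist (L i w) _ _))// [X in _ + X]sabsC; lra.
pose c (n : nat) : R := n.+1%:R^-1.
have cp n : 0 < c n by rewrite invr_gt0.
have cc : c n @[n --> \oo] --> 0 by exact: cvg_harmonic.
have /choice[B hB] n : exists B, F B /\ forall u v, B u -> B v -> `|u - v| <= sof (c n).
  by have [B] := small _ (cp n); exists B.
have FBn n : F [set u | forall m, (m < n)%N -> B m u].
  elim: n => [|n IH]; first by apply: filterS FA.
  apply: filterS2 IH (hB n).1 => u h1 h2 m; rewrite ltnS leq_eqVlt.
  by move=> /orP[/eqP ->//|]; exact: h1.
(* [u n] lies in B 0, ..., B n, so that [u m] and [u n] share [B n] whenever n <= m. *)
have /choice[u hu] n : exists u, forall m, (m < n.+1)%N -> B m u.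
  by have /filter_ex := FBn n.+1.
have [|l hl] := @Linfty_complete u c (fun n => ltW (cp n)) cc.
  move=> n m nm; apply: (hB n).2; apply: hu => //.
have Fl : F --> l.
  move=> V /nbhs_ballP[e /= e0 eV].
  have er0 : 0 < sre e by rewrite -(@lt_sof R k) sof0 sof_sre// ltW.
  have : \forall n \near \oo, c n < sre e / 2.
    by apply: (cvgr_lt 0) => //; rewrite divr_gt0.
  (* Members of [B n] are within c n of [u n], which is within c n of [l]. *)
  move=> /filter_ex[n cn]; apply: filterS (hB n).1 => v Bv; apply: eV.
  rewrite -ball_normE /ball_ /= -[ltRHS]sof_sre ?ltW//.
  rewrite -(subrK (u n) l) -addrA (le_lt_trans (ler_normD _ _))//.
  apply: (@le_lt_trans _ _ (sof (c n + c n))); last by rewrite lt_sof; lra.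
  by rewrite sofD lerD// ?(distrC l)//; apply: (hB n).2 => //; exact: hu.
exists l; split=> //.
exact: (@closed_cvg _ _ F _ id (closure A) (@closed_closure _ A)).
Unshelve. all: by end_near. Qed.

End Linfty_norm.

(** * Fragmentability implies the Asplund property *)

Section weak_star.
Context {R : realType} {k : scalars} {E : normedModType (scalar_field R k)}.
Local Notation K := (scalar_field R k).

Lemma wstar_cvg (F : set_system (wstar_dual E)) {FF : Filter F} (f : wstar_dual E) :
  (forall (x : E) (r : R), 0 < r ->
    \forall g \near F, sabs ((g : dual E) x - (f : dual E) x) < r) ->
  F --> f.
Proof.
move=> h V [_ [[B oB <-] Bf] sBV].
pose ev (g : dual E) : {ptws E -> K} := g : E -> K.
have : {ptws, (ev @ F) --> (ev f)}.
  apply/pointwise_cvgP => x; apply/cvgrPdist_lt => e e0.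
  have r0 : 0 < sre e by rewrite -(@lt_sof R k) sof0 sof_sre// ltW.
  apply: filterS (h x _ r0) => g /=; rewrite -(@lt_sof R k) sof_sabs sof_sre ?ltW//.
  by rewrite distrC.
move=> /(_ B) hB; apply: (@filterS _ F _ (ev @^-1` B)) => //.
by apply: hB; exact: open_nbhs_nbhs.
Qed.

Lemma wstar_open_disc (x : E) (c : K) (r : R) :
  open [set g : wstar_dual E | sabs ((g : dual E) x - c) < r].
Proof.
pose ev (g : wstar_dual E) : {ptws E -> K} := (g : dual E) : E -> K.
pose D := [set g : {ptws E -> K} | sabs (g x - c) < r].
rewrite (_ : [set g | _] = ev @^-1` D)//.
apply: open_comp => [g _|]; first exact: initial_continuous.
rewrite (_ : D = (fun g : {ptws E -> K} => g x) @^-1` ball c (sof r)).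
  apply: open_comp; last exact: ball_open.
  by move=> g _; exact: (@proj_continuous _ (fun=> K) x).
by apply/seteqP; split=> g /=; rewrite /D /= -ball_normE /ball_ /= distrC
  -sof_sabs lt_sof.
Qed.

End weak_star.

Section measure_exhaustion.
Context {R : realType} {d} {Omega : measurableType d}.

(* A countable union of members of [G] whose measures approach the supremum
   must be conull. *)
Lemma measure_exhaustion (mu : {finite_measure set Omega -> \bar R})
    (G : set (set Omega)) :
  G `<=` measurable -> G set0 -> (forall A B, G A -> G B -> G (A `|` B)) ->
  (forall A, measurable A -> (0 < mu A)%E ->
    exists B, [/\ B `<=` A, G B & (0 < mu B)%E]) ->
  forall e : R, 0 < e -> exists2 B, G B & (mu (~` B) < e%:E)%E.
Proof.
move=> mG G0 GU Gsub e e0.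
pose m (A : set Omega) : R := fine (mu A).
have mE A : measurable A -> mu A = (m A)%:E.
  by move=> mA; rewrite /m fineK// fin_num_measure.
have le_m A B : measurable A -> measurable B -> A `<=` B -> m A <= m B.
  by move=> mA mB AB; rewrite -lee_fin -!mE// le_measure// inE.
have muC A : measurable A -> mu setT = (mu A + mu (~` A))%E.
  by move=> mA; rewrite -measureU ?setUv ?setICr//; exact: measurableC.
have hs : has_sup [set m A | A in G].
  split; first by exists (m set0), set0.
  by exists (m setT) => _ [A GA <-]; apply: le_m => //; exact: mG.
pose s : R := sup [set m A | A in G].
have ms A : G A -> m A <= s by move=> GA; apply: sup_ubound => //; [case: hs|exists A].
have /choice[B hB] (n : nat) : exists B, G B /\ s - n.+1%:R^-1 < m B.
  have n0 : 0 < n.+1%:R^-1 :> R by rewrite invr_gt0.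
  by have [_ [B GB <-] sB] := sup_adherent n0 hs; exists B.
have mB n : measurable (B n) by apply: mG; exact: (hB n).1.
have mUB : measurable (\bigcup_n B n) by exact: bigcup_measurable.
(* A member of [G] of positive measure in the complement, added to a [B n] of measure close enough
   to [s], would exceed the supremum. *)
have nullC : mu (~` \bigcup_n B n) = 0%E.
  apply/eqP; rewrite eq_le measure_ge0 andbT leNgt; apply/negP => p.
  have [D [DC GD Dp]] := Gsub _ (measurableC mUB) p.
  have mD := mG _ GD; have m0 : 0 < m D by rewrite -lte_fin -mE.
  have : \forall n \near \oo, (n.+1%:R^-1 : R) < m D.
    by apply: (cvgr_lt 0) => //; exact: cvg_harmonic.
  move=> /filter_ex[n hn].
  have : m (B n `|` D) <= s by apply: ms; apply: GU => //; exact: (hB n).1.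
  have -> : m (B n `|` D) = m (B n) + m D.
    apply: EFin_inj; rewrite EFinD -!mE//; last exact: measurableU.
    rewrite measureU//; apply/seteqP; split=> // w [Bw /DC]; apply.
    by exists n.
  by move=> /(lt_le_trans (ltrD (hB n).2 hn)); rewrite subrK ltxx.
(* The finite unions stay in [G] and increase to a conull set, so one of them already leaves less
   than e. *)
pose C n := \big[setU/set0]_(i < n.+1) B i.
have GC n : G (C n) by apply: big_ind => // i _; exact: (hB i).1.
have UC : \bigcup_n C n = \bigcup_n B n.
  by rewrite -[RHS]bigcup_bigsetU_bigcup.
have : (mu \o C) n @[n --> \oo] --> mu (\bigcup_n C n).
  apply: nondecreasing_cvg_mu => [n||n p np].
  - exact: mG.
  - by rewrite UC.
  - by apply/subsetPset/subset_bigsetU.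
have -> : mu (\bigcup_n C n) = (m setT)%:E.
  by rewrite UC -mE// (muC _ mUB) nullC adde0.
move=> /fine_cvgP[_ cm].
have : \forall n \near \oo, m setT - e < m (C n).
  by apply: (cvgr_gt _ cm); rewrite ltrBlDr ltrDl.
move=> /filter_ex[n hn]; exists (C n) => //.
have mC : measurable (C n) by exact: mG.
have := muC _ mC; rewrite !mE//; last exact: measurableC.
by move=> -[]; rewrite lte_fin; move: hn => /=; lra.
Qed.

(** The conull filter restricted to [W] is proper exactly because [W] is not negligible; [W] may be
    nonmeasurable. *)
Lemma not_ae_ultra (mu : {measure set Omega -> \bar R}) (W : set Omega) :
  ~ (\forall w \ae mu, ~ W w) ->
  exists U : set_system Omega, [/\ UltraFilter U, almost_everywhere mu `<=` U & U W].
Proof.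
move=> nW; have PF : ProperFilter (within W (almost_everywhere mu)).
  split; last exact: within_filter.
  by move=> h; apply: nW; apply: filterS h.
have [U [UU hU]] := ultraFilterLemma PF.
exists U; split=> // [A hA|]; apply: hU; first by apply: filterS hA.
exact: nearW.
Qed.

Lemma positive_not_ae (mu : {measure set Omega -> \bar R}) (A : set Omega) :
  measurable A -> (0 < mu A)%E <-> ~ (\forall w \ae mu, ~ A w).
Proof.
move=> mA; split=> [A0 [N [mN N0 sub]]|nA].
  move: A0; rewrite lt_neqAle => /andP[/eqP]; case.
  apply/esym; apply: (subset_measure0 mA mN) => // w Aw.
  by apply: sub => /=; apply.
rewrite lt_neqAle measure_ge0 andbT; apply/eqP => A0.
by apply: nA; exists A; split=> // w /=; exact: contrapT.
Qed.

End measure_exhaustion.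

Section scalar_net.
Context {R : realType} {k : scalars}.
Local Notation K := (scalar_field R k).

Lemma scalar_net (C e : R) : 0 < e ->
  exists (I : finType) (c : I -> K), forall x, sabs x <= C -> exists i, sabs (x - c i) <= e.
Proof.
(* The interval [-C, C] has room for 4 * C / e steps of length e / 2; each coordinate contributes an
   error of at most e / 2. *)
move=> e0; pose N := (Num.truncn (4 * C / e)).+1.
pose p (i : 'I_N.+1) : R := i%:R * (e / 2) - C.
have net (x : R) : `|x| <= C -> exists i, `|x - p i| <= e / 2.
  rewrite ler_norml => /andP[Cx xC].
  have e20 : 0 < e / 2 by rewrite divr_gt0.
  have x0 : 0 <= (x + C) / (e / 2) by apply: divr_ge0; [lra|exact: ltW].
  have iN : (Num.truncn ((x + C) / (e / 2)) < N.+1)%N.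
    rewrite ltnS (leq_trans _ (leqnSn _))// Num.Theory.le_truncn//.
    rewrite ler_pdivrMr// (_ : 4 * C / e * (e / 2) = 2 * C); last by field; rewrite gt_eqF.
    by lra.
  exists (Ordinal iN); rewrite /p/=.
  have /andP[h1 h2] := truncn_itv x0.
  have nS n : n.+1%:R = n%:R + 1 :> R by rewrite natr1.
  move: h1 h2; rewrite nS ler_pdivlMr// ltr_pdivrMr// => h1 h2.
  by rewrite ler_norml; apply/andP; split; lra.
exists ('I_N.+1 * 'I_N.+1)%type, (fun ij => smk (p ij.1) (p ij.2)) => x xC.
have [i hi] := net (sre x) (le_trans (le_sre_sabs _) xC).
have [j hj] := net (sim x) (le_trans (le_sim_sabs _) xC).
exists (i, j); rewrite (le_trans (sabs_le_reim _))// sreB simB sre_smk/=.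
have : `|sim x - sim (smk (p i) (p j) : K)| <= e / 2.
  have [k0|k0] : k = RealScalars \/ k <> RealScalars by case: (k); [left|right].
    by rewrite !sim_real// subr0 normr0 ltW// divr_gt0.
  by rewrite sim_smk.
by lra.
Qed.

End scalar_net.

Section adjoint_ball.
Context {R : realType} {k : scalars} {E F : normedModType (scalar_field R k)}.
Local Notation K := (scalar_field R k).

Definition adjoint_ball (T : operator E F) : set (wstar_dual E) :=
  [set adjoint T f | f in @dual_ball R k F].

End adjoint_ball.

Section fragmented_Asplund.
Context {R : realType} {k : scalars} {E F : normedModType (scalar_field R k)}.
Variable T : operator E F.
Hypothesis fragT : fragmented (adjoint_ball T).
Context {d : measure_display} {Omega : measurableType d}.
Variable mu : {finite_measure set Omega -> \bar R}.
Variable S : operator F (Linfty k mu).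
Local Notation K := (scalar_field R k).
Let st (x : E) : Omega -> K := repr (S (T x)).

Variable M : R.
Hypothesis M0 : 0 < M.
Hypothesis SM : forall y, `|S y| <= sof M * `|y|.

Let ae_S y : \forall w \ae mu, sabs (repr (S y) w) <= M * sre `|y|.
Proof.
have n0 : 0 <= sre `|y| by rewrite -(@le_sof R k) sof_norm sof0.
apply/Linfty_norm_leP; first by rewrite mulr_ge0// ltW.
by rewrite sofM sof_norm.
Qed.

Section functional.
Variable U : set_system Omega.
Hypotheses (UU : UltraFilter U) (aeU : almost_everywhere mu `<=` U).

Let sb y : sbounded U (repr (S y)).
Proof. by exists (M * sre `|y|); exact: aeU (ae_S y). Qed.

(** Since [U] contains every conull set, the limit of [S y] respects identities that hold almost
    everywhere, whence linearity in [y]. Division by [M], a bound of [S], brings the functional into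
    the dual ball. *)
Lemma ultra_functional : exists f : dual F, @dual_ball R k F f /\
  forall y, sof M * (f : F -> K) y = slim U (repr (S y)).
Proof.
pose h y : K := sof M^-1 * slim U (repr (S y)).
have Mn0 : sof M != 0 :> K by rewrite sof_eq0 gt_eqF.
have hE y : sof M * h y = slim U (repr (S y)).
  by rewrite mulrA -sofM mulfV ?gt_eqF// sof1 mul1r.
have lh : linear (h : F -> K^o).
  move=> a x y; apply: (mulfI Mn0); rewrite hE mulrDr hE.
  have -> : sof M * (a *: (h x : K^o)) = a * (sof M * h x) :> K.
    exact: mulrCA.
  rewrite hE; apply: slim_linear => //; rewrite linearP.
  exact/aeU/Linfty_repr_linear.
have hb x : sabs (h x) <= sre `|x|.
  rewrite -(ler_pM2l M0) -[M in M * sabs _](@sabs_sof R k _ (ltW M0)) -sabsM hE.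
  rewrite -[slim _ _]subr0.
 apply: slim_dist_le => //.
  by apply: aeU; apply: filterS (ae_S x) => w; rewrite subr0.
have [f fE] : exists f : dual F, f =1 (h : F -> K^o).
  apply: (@exists_operator R k F K^o h 1 lh) => x.
  by rewrite sof1 mul1r -[ `|x|]sof_norm -[ `|h x|]sof_sabs le_sof.
exists f; split=> [|y]; last by rewrite fE.
apply/functional_norm_leP => x x1; rewrite fE (le_trans (hb x))//.
by rewrite -(@le_sof R k) sof_norm sof1.
Qed.

End functional.

(** A small piece of the functionals coming from ultrafilters containing [A] includes those of all
    ultrafilters containing some [A]&[A']. Along these, the limits of ST x nearly agree, uniformly
    for x in the unit ball. The bound on [c] allows a finite net of constants later. *)
Lemma small_oscillation (A : set Omega) (e : R) : 0 < e -> measurable A -> (0 < mu A)%E ->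
  exists B, [/\ B `<=` A, measurable B, (0 < mu B)%E &
    forall x : E, `|x| <= 1 -> exists c : K, sabs c <= M * sre `|T x| /\
      \forall w \ae mu, B w -> sabs (st x w - c) <= e].
Proof.
move=> e0 mA A0; have e20 : 0 < e / 2 by rewrite divr_gt0.
pose conull U := UltraFilter U /\ almost_everywhere mu `<=` U.
pose realizes U (f : dual F) := @dual_ball R k F f /\
  forall y, sof M * (f : F -> K) y = slim U (repr (S y)).
pose P (A' : set Omega) : set (wstar_dual E) :=
  [set g | exists U f, [/\ conull U, U A', realizes U f & g = adjoint T f]].
(* Limits of ST x are [M] times values of the functionals, so diameter e / 2 / M means that the
   limits differ by at most e / 2 < e. *)
have [||V [oV [g0 [[U0 [f0 [[UU0 aeU0] U0A rf0 ->]]] Vg0]] dV]] := @fragT (e / 2 / M) (P A)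
    (divr_gt0 e20 M0).
- by move=> _ [U [f [_ _ [fb _] ->]]]; exists f.
- have /(positive_not_ae _ mA)/not_ae_ultra[U [UU aeU UA]] := A0.
  have [f hf] := ultra_functional UU aeU.
  by exists (adjoint T f); exists U, f.
have sb (U : set_system Omega) (y : F) : conull U -> sbounded U (repr (S y)).
  by move=> [_ aeU]; exists (M * sre `|y|); exact: aeU (ae_S y).
(* The image, under U |-> T* f_U, of the neighborhood filter of [U0] in the
   Stone space of conull ultrafilters; it converges to [T* f0]. *)
pose H : set_system (wstar_dual E) := fun X => exists A', [/\ measurable A', U0 A' & P A' `<=` X].
have FH : Filter H.
  split; first by exists setT; split=> //; exact: filterT.
  - move=> X Y [A1 [m1 U1 h1]] [A2 [m2 U2 h2]]; exists (A1 `&` A2); split.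
    + exact: measurableI.
    + exact: filterI.
    + by move=> _ [U [f [cU UA hf ->]]]; split; [apply: h1|apply: h2]; exists U, f;
        split=> //; case: cU => UU _; apply: filterS UA => w [].
  - by move=> X Y XY [A1 [m1 U1 h1]]; exists A1; split=> //; exact: subset_trans XY.
have HV : H V.
  suff : H --> (adjoint T f0 : wstar_dual E) by apply; exact: open_nbhs_nbhs.
  apply: wstar_cvg => x r r0; pose c := slim U0 (st x).
  (* If [U] contains this set, the limit of ST x along [U] is within M * r / 2 < M * r of [c], so
     the two functionals differ by less than r at x. *)
  exists [set w | sabs (st x w - c) < M * r / 2]; split.
  - have := smeasurable_sabs (smeasurableD (smeasurable_repr (S (T x))) (smeasurable_cst (- c))).
    move=> /(_ measurableT _ (measurable_itv `]-oo, M * r / 2[)); rewrite setTI.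
    by congr (measurable _); apply/seteqP; split=> w /=; rewrite in_itv.
  - apply: slim_dist_lt; first exact: sb.
    by rewrite subrr sabs0 divr_gt0// mulr_gt0.
  - move=> _ [U [f [[UU aeU] UA [_ hf] ->]]] /=.
    rewrite -(ltr_pM2l M0) -[M in M * sabs _](@sabs_sof R k _ (ltW M0)) -sabsM mulrBr hf rf0.2.
    apply: (@le_lt_trans _ _ (M * r / 2)); last first.
      by have := mulr_gt0 M0 r0; lra.
    apply: slim_dist_le; first exact: sb.
    by apply: filterS UA => w /ltW.
have [A' [mA' U0A' A'V]] := HV.
exists (A `&` A'); split=> [w []//|||x x1].
- exact: measurableI.
- apply/positive_not_ae; first exact: measurableI.
  move=> /aeU0 h; have : U0 (~` (A `&` A') `&` (A `&` A')).
    by apply: filterI h _; exact: filterI.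
  by move=> /filter_ex[w []].
- exists (slim U0 (st x)); split.
    rewrite -[slim _ _]subr0; apply: slim_dist_le; first exact: sb.
    by apply: aeU0; apply: filterS (ae_S (T x)) => w; rewrite subr0.
  (* If [W] were not negligible, a conull ultrafilter containing it would yield a functional in the
     same piece, with limit of ST x within e / 2 of that along [U0]; but on [W] the distance exceeds
     e. *)
  pose W := [set w | (A `&` A') w /\ ~ sabs (st x w - slim U0 (st x)) <= e].
  apply: contrapT => nW; have : ~ \forall w \ae mu, ~ W w.
    by apply: contra_not nW; apply: filterS => w nWw AA; apply: contrapT => h; exact: nWw.
  move=> /not_ae_ultra[U [UU aeU UW]].
  have [f rf] := ultra_functional UU aeU.
  have UA : U A by apply: filterS UW => w [[]].
  have UA' : U A' by apply: filterS UW => w [[]].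
  have UAA : U (A `&` A') by apply: filterS UW => w [].
  have Pf : (P A `&` V) (adjoint T f).
    by split; [|apply: A'V]; exists U, f; split=> //; apply: filterS UAA => w [].
  have Pf0 : (P A `&` V) (adjoint T f0) by split=> //; exists U0, f0.
  have /dual_diam_leP/(_ _ _ Pf Pf0 x x1)/= := dV.
  rewrite ler_pdivlMr// mulrC -[X in X * sabs _](@sabs_sof R k _ (ltW M0)) -sabsM mulrBr rf.2 rf0.2.
  move=> h; have : U (W `&` [set w | sabs (st x w - slim U0 (st x)) < e]).
    apply: filterI => //; apply: slim_dist_lt; first exact: sb.
    by apply: le_lt_trans h _; lra.
  by move=> /filter_ex[w [[_ nle] /ltW]].
Qed.

(** The centres are functions and not constants, so that they can be glued and [approx] is stable
    under finite unions. *)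
Let approx (e : R) (B : set Omega) := measurable B /\
  exists (I : finType) (L : I -> Omega -> K), forall x : E, `|x| <= 1 ->
    exists i, \forall w \ae mu, B w -> sabs (st x w - L i w) <= e.

Let approxU e A B : approx e A -> approx e B -> approx e (A `|` B).
Proof.
move=> [mA [I [L hL]]] [mB [J [N hN]]]; split; first exact: measurableU.
exists (I * J)%type, (fun ij w => if `[< A w >] then L ij.1 w else N ij.2 w).
move=> x x1; have [i hi] := hL x x1; have [j hj] := hN x x1; exists (i, j).
apply: filterS2 hi hj => w hi hj /= AB; case: asboolP => [/hi//|nA].
by apply: hj; case: AB.
Qed.

(** The constants given by [small_oscillation] lie in the disc of radius M * C, which has a finite e
    / 2-net. *)
Let approx_exists (e : R) (A : set Omega) : 0 < e -> measurable A -> (0 < mu A)%E ->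
  exists B, [/\ B `<=` A, approx e B & (0 < mu B)%E].
Proof.
move=> e0 mA A0; have e20 : 0 < e / 2 by rewrite divr_gt0.
have [B [BA mB B0 hB]] := small_oscillation e20 mA A0.
have [C C0 TC] := operator_bound T.
have [I [c hc]] := @scalar_net R k (M * C) (e / 2) e20.
exists B; split=> //; split=> //; exists I, (fun i _ => c i) => x x1.
have [c' [c'M hc']] := hB x x1; have [|i hi] := hc c'.
  apply: le_trans c'M _; rewrite ler_pM2l// -(@le_sof R k) sof_norm.
  by rewrite (le_trans (TC x))// ler_piMr// -sof0 le_sof ltW.
exists i; apply: filterS hc' => w hw /hw h.
by rewrite (le_trans (sabs_dist c' _ _))//; lra.
Qed.

(** For each n, exhaustion gives a set on which ST(B_E) is covered up to 1 / (n + 1); the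
    intersection of these sets serves all precisions at once. *)
Lemma fragmented_precompact (e : R) : 0 < e ->
  exists (B : set Omega) (mB : measurable B), (mu setT - e%:E < mu B)%E /\
    precompact [set Linfty_mul_indic mB f
               | f in [set S (T x) | x in closed_unit_ball E]].
Proof.
move=> e0; have e20 : 0 < e / 2 by rewrite divr_gt0.
pose a (n : nat) : R := n.+1%:R^-1.
(* These sum to e / 2, which leaves room for the strict inequality on the measure. *)
pose b (n : nat) : R := e / 2 / (2 ^ n.+1)%:R.
have /choice[B hB] n : exists B, approx (a n) B /\ (mu (~` B) < (b n)%:E)%E.
  have an0 : 0 < a n by rewrite invr_gt0.
  have [| | | | |B GB hB] := @measure_exhaustion R d Omega mu (approx (a n)) _ _ _ _ (b n).
  - by move=> A [].
  - split=> //; exists unit, (fun _ _ => 0) => x _; exists tt.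
    exact: nearW.
  - exact: approxU.
  - by move=> A mA A0; apply: approx_exists.
  - by rewrite divr_gt0// ltr0n expn_gt0.
  - by exists B.
have mB n : measurable (B n) by case: (hB n) => -[].
have mIB : measurable (\bigcap_n B n) by exact: bigcap_measurable.
exists (\bigcap_n B n), mIB; split.
  have hC : (mu (~` \bigcap_n B n) <= (e / 2)%:E)%E.
    rewrite setC_bigcap; apply: le_trans.
      apply: (@measure_sigma_subadditive _ _ _ mu _ (fun n => ~` B n)) => //.
      - by move=> n; exact: measurableC.
      - by apply: bigcup_measurable => n _; exact: measurableC.
    apply: le_trans (_ : (\sum_(0 <= n <oo) (0%R + (b n)%:E)%E <= _)%E).
      by apply: lee_nneseries => // n _; rewrite add0e; exact: ltW (hB n).2.
    apply: le_trans (epsilon_trick xpredT _ _) _ => //; first exact: ltW.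
    by rewrite eseries0// add0e.
  have -> : mu setT = (mu (\bigcap_n B n) + mu (~` \bigcap_n B n))%E.
    by rewrite -measureU ?setUv ?setICr//; exact: measurableC.
  have : mu (~` \bigcap_n B n) \is a fin_num.
    by apply: fin_num_measure; exact: measurableC.
  have : mu (\bigcap_n B n) \is a fin_num by exact: fin_num_measure.
  move: hC; case: (mu (~` _)) => // y; case: (mu _) => // x.
  by rewrite lee_fin => h _ _; rewrite -EFinN -!EFinD lte_fin; lra.
apply: totally_bounded_precompact => r r0.
have : \forall n \near \oo, a n < r.
  by apply: (cvgr_lt 0) => //; exact: cvg_harmonic.
move=> /filter_ex[n an]; have [[_ [J [L hL]]] _] := hB n.
exists J, (fun i => L i \* \1_(\bigcap_n B n)) => _ [_ [x x1 <-] <-].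
have [i hi] := hL x x1; exists i.
have := Linfty_repr (LinfFun (Linf_mul_indic_subproof mIB (repr (S (T x))))).
apply: filterS2 hi => w hi /(_ I) -> /=.
rewrite -mulrBl sabsM indicE; have [wB|_] := boolP (w \in _); last first.
  by rewrite sabs0 mulr0 ltW.
rewrite -sof1 sabs_sof// mulr1 (le_trans (hi _)) ?ltW//.
by move: wB; rewrite inE => /(_ n I).
Qed.

End fragmented_Asplund.

(** * Weak limits of bounded functions *)

Section dominated_charge.
Context {R : realType} {d} {Omega : measurableType d}.
Variable mu : {finite_measure set Omega -> \bar R}.

Definition real_additive (p : set Omega -> R) := forall A B, measurable A ->
  measurable B -> A `&` B = set0 -> p (A `|` B) = p A + p B.

(** Used for [p] and for the measure dominating it: the remainder of the first is controlled by that
    of the second, which tends to 0. *)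
Lemma real_additive_tail (p : set Omega -> R) (F : nat -> set Omega) :
  real_additive p -> (forall i, measurable (F i)) -> trivIset setT F ->
  forall n, p (\bigcup_i F i) = \sum_(0 <= i < n) p (F i) +
    p (\bigcup_i F i `\` \big[setU/set0]_(i < n) F i).
Proof.
move=> addp mF tF n.
have mU : measurable (\bigcup_i F i) by exact: bigcup_measurable.
have mS m : measurable (\big[setU/set0]_(i < m) F i) by exact: bigsetU_measurable.
elim: n => [|n IH]; first by rewrite big_geq// big_ord0 setD0 add0r.
rewrite IH big_nat_recr//= -addrA; congr (_ + _).
rewrite -addp//; last 2 first.
- exact: measurableD mU (mS _).
- by apply/seteqP; split=> // w [Fw [_]]; apply; rewrite big_ord_recr/=; right.
congr p; apply/seteqP; split=> w.
  move=> [Uw nw]; have [Fw|nF] := pselect (F n w); first by left.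
  by right; split=> //; rewrite big_ord_recr/= => -[].
move=> [Fw|[Uw nw]]; split=> //; first by exists n.
- rewrite -bigcup_mkord => -[m /= mn Fm]; have := tF m n I I.
  by move=> /(_ (ex_intro _ w (conj Fm Fw))) mn'; rewrite mn' ltnn in mn.
- by move=> h; apply: nw; rewrite big_ord_recr/=; left.
Qed.

(** Domination by [mu] makes [p] both sigma-additive and absolutely continuous, so that the
    Radon-Nikodym theorem applies. *)
Lemma dominated_density (p : set Omega -> R) (M : R) : real_additive p ->
  (forall A, measurable A -> `|p A| <= M * fine (mu A)) ->
  exists h : Omega -> R, mu.-integrable setT (EFin \o h) /\
    forall A, measurable A -> p A = \int[mu]_(x in A) h x.
Proof.
move=> addp pM; pose m (A : set Omega) : R := fine (mu A).
have mE A : measurable A -> mu A = (m A)%:E.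
  by move=> mA; rewrite /m fineK// fin_num_measure.
have addm : real_additive m.
  move=> A B mA mB AB; apply: EFin_inj; rewrite EFinD -!mE//; last exact: measurableU.
  by rewrite measureU.
pose nu (A : set Omega) : \bar R := (p A)%:E.
have nu0 : nu set0 = 0%E.
  congr EFin; apply/eqP; rewrite -normr_le0 (le_trans (pM _ _))//.
  by rewrite measure0 mulr0.
have nufin A : measurable A -> nu A \is a fin_num by [].
have nusig : semi_sigma_additive nu.
  move=> F mF tF mU; rewrite /nu.
  have -> : (fun n => (\sum_(0 <= i < n) (p (F i))%:E)%E) =
            (EFin \o (fun n => \sum_(0 <= i < n) p (F i))).
    by apply/funext => n /=; rewrite sumEFin.
  apply: cvg_EFin; first exact: nearW.
  rewrite [X in X @ _]/(_ \o _) /=.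
  have /fine_cvgP[_ cm] : (EFin \o (fun n => \sum_(0 <= i < n) m (F i))) n @[n --> \oo]
      --> (m (\bigcup_i F i))%:E.
    rewrite -mE//; have := @measure_semi_sigma_additive _ _ _ mu F mF tF mU.
    apply: cvg_trans; apply: near_eq_cvg; apply: nearW => n /=.
    by rewrite -sumEFin; apply: eq_bigr => i _; rewrite mE.
  apply/cvgrPdist_le => e e0.
  (* [M] carries no sign assumption; |M| + 1 is a positive substitute. *)
  have M1 : 0 < `|M| + 1 by rewrite ltr_pwDr.
  move/cvgrPdist_le : cm => /(_ (e / (`|M| + 1)) (divr_gt0 e0 M1)).
  apply: filterS => n /=.
  rewrite [m (\bigcup_i _)](real_additive_tail addm mF tF n).
  rewrite [p (\bigcup_i _)](real_additive_tail addp mF tF n).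
  rewrite ![\sum_(0 <= _ < _) _ + _]addrC !addrK ler_pdivlMr// => h.
  set A := _ `\` _ in h *.
  have mA : measurable A by apply: measurableD => //; exact: bigsetU_measurable.
  rewrite (le_trans (pM _ mA))//; apply: le_trans h; rewrite mulrC.
  have m0 : 0 <= fine (mu A) by exact: fine_ge0.
  by rewrite [m A]/(fine _) ger0_norm// ler_wpM2l// (le_trans (ler_norm _))// lerDl.
pose nuc : {charge set Omega -> \bar R} :=
  HB.pack nu (isCharge.Build _ _ _ nu nu0 nufin nusig).
have dom : nuc `<< mu.
  apply/null_content_dominatesP => A mA mA0; congr EFin; apply/eqP.
  by rewrite -normr_le0 (le_trans (pM _ mA))// mA0 mulr0.
exists (fine \o (Radon_Nikodym nuc mu)).
have hE : EFin \o (fine \o (Radon_Nikodym nuc mu)) = Radon_Nikodym nuc mu.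
  by apply/funext => x /=; rewrite fineK// Radon_Nikodym_fin_num.
split=> [|A mA]; first by rewrite hE; exact: Radon_Nikodym_integrable.
apply: EFin_inj; rewrite -[LHS]/(nuc A) (Radon_Nikodym_integral dom mA).
rewrite /Rintegral; under [in RHS]eq_integral do rewrite fineK ?Radon_Nikodym_fin_num//.
by rewrite fineK// -Radon_Nikodym_integral.
Qed.

End dominated_charge.

Section weak_limits.
Context {R : realType} {d} {Omega : measurableType d}.
Variable mu : {finite_measure set Omega -> \bar R}.
Variables (U : set_system nat) (UU : UltraFilter U).
Implicit Types (g : nat -> Omega -> R) (h : Omega -> R).

Definition rintegrable h := mu.-integrable setT (EFin \o h).

(** Testing against characteristic functions determines [h] almost everywhere, see
    [weak_limit_unique]. *)
Definition weak_limit g h := [/\ rintegrable h, forall n, rintegrable (g n) &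
  forall A, measurable A ->
    (\int[mu]_(x in A) g n x) @[n --> U] --> \int[mu]_(x in A) h x].

Lemma rintegrableS h A : measurable A -> rintegrable h -> mu.-integrable A (EFin \o h).
Proof. by move=> mA; apply: integrableS. Qed.

Lemma rintegrable_measurable h : rintegrable h -> measurable_fun setT h.
Proof. by move=> /measurable_int/measurable_EFinP. Qed.

Lemma rintegrable_cst (c : R) : rintegrable (cst c).
Proof. exact: finite_measure_integrable_cst. Qed.

Lemma bounded_rintegrable h (M : R) : measurable_fun setT h -> (forall w, `|h w| <= M) ->
  rintegrable h.
Proof.
move=> mh hM; apply: (@le_integrable _ _ _ mu _ measurableT (EFin \o h) (EFin \o cst M)).
- exact/measurable_EFinP.
- by move=> w _ /=; rewrite lee_fin (le_trans (hM w))// ler_norm.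
- exact: rintegrable_cst.
Qed.

Lemma rintegrable_linear (a : R) h h' : rintegrable h -> rintegrable h' ->
  rintegrable (fun w => a * h w + h' w).
Proof.
move=> ih ih'; rewrite /rintegrable.
rewrite (_ : EFin \o _ = (fun w => a%:E * (EFin \o h) w + (EFin \o h') w)%E).
  by apply: integrableD => //; exact: integrableZl.
by apply/funext => w /=; rewrite EFinD EFinM.
Qed.

Lemma Rintegral_linear (a : R) h h' A : measurable A -> rintegrable h -> rintegrable h' ->
  \int[mu]_(x in A) (a * h x + h' x) =
  a * (\int[mu]_(x in A) h x) + \int[mu]_(x in A) h' x.
Proof.
move=> mA /(rintegrableS mA) ih /(rintegrableS mA) ih'.
rewrite RintegralD//; last first.
  rewrite (_ : EFin \o _ = (fun w => a%:E * (EFin \o h) w)%E); first exact: integrableZl.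
  by apply/funext => w /=; rewrite EFinM.
by rewrite RintegralZl.
Qed.

(** The limits along [U] of the integrals over [A] form an additive function of [A] dominated by M *
    mu; its density is the weak limit. *)
Lemma weak_limit_exists g (M : R) : (forall n, measurable_fun setT (g n)) ->
  (forall n w, `|g n w| <= M) -> exists h, weak_limit g h.
Proof.
move=> mg gM.
have ig n : rintegrable (g n) by exact: bounded_rintegrable (mg n) (gM n).
have bA n A : measurable A -> `|\int[mu]_(x in A) g n x| <= M * fine (mu A).
  move=> mA; rewrite (le_trans (le_normr_Rintegral _ _))//; first exact: rintegrableS.
  rewrite -Rintegral_cst//; apply: le_Rintegral => //.
    exact: (integrable_norm (rintegrableS mA (ig n))).
  exact: rintegrableS mA (rintegrable_cst M).
pose p A := lim ((\int[mu]_(x in A) g n x) @[n --> U]).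
have pc A : measurable A -> (\int[mu]_(x in A) g n x) @[n --> U] --> p A.
  by move=> mA; apply: (@ultra_cvg _ _ _ UU _ (M * fine (mu A))); apply: nearW => n; exact: bA.
have [||h [ih hE]] := @dominated_density _ _ _ mu p M.
- move=> A B mA mB AB.
  have pAB : (\int[mu]_(x in A `|` B) g n x) @[n --> U] --> p A + p B.
    rewrite (_ : (fun n => _) =
        (fun n => \int[mu]_(x in A) g n x + \int[mu]_(x in B) g n x)).
      by apply: cvgD; exact: pc.
    apply/funext => n; rewrite Rintegral_setU//; last exact/disj_set2P.
    by apply: rintegrableS (ig n); exact: measurableU.
  by apply: (cvg_unique _ (pc _ (measurableU _ _ mA mB)) pAB); exact: norm_hausdorff.
- move=> A mA; apply: cvgr_to_le (cvg_norm (pc A mA)) _.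
  by apply: nearW => n; exact: bA.
- by exists h; split=> // A mA; rewrite -hE//; exact: pc.
Qed.

Lemma weak_limit_linear (a : R) g g' h h' : weak_limit g h -> weak_limit g' h' ->
  weak_limit (fun n w => a * g n w + g' n w) (fun w => a * h w + h' w).
Proof.
move=> [ih ig cg] [ih' ig' cg']; split=> [|n|A mA]; try exact: rintegrable_linear.
rewrite Rintegral_linear//; under eq_fun do rewrite Rintegral_linear//.
by apply: cvgD; [apply: cvgMr; exact: cg|exact: cg'].
Qed.

(** On the part of [A] where h >= c + 1 / (n + 1), the integral of [h] is at most c times the
    measure, as a limit of such integrals; so this part is null. *)
Lemma weak_limit_le g h A (c : R) : weak_limit g h -> measurable A ->
  (\forall n \near U, forall w, A w -> g n w <= c) ->
  \forall w \ae mu, A w -> h w <= c.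
Proof.
move=> [ih ig cg] mA gc; have mh := rintegrable_measurable ih.
pose B n := A `&` [set w | c + n.+1%:R^-1 <= h w].
have mB n : measurable (B n).
  apply: measurableI => //; rewrite -[X in measurable X]setTI.
  by apply: (measurable_fun_le _ _) => //; exact: measurable_cst.
have small n : mu (B n) = 0%E.
  have hB1 : \int[mu]_(x in B n) h x <= c * fine (mu (B n)).
    apply: cvgr_to_le (cg _ (mB n)) _; apply: filterS gc => m gc.
    rewrite -Rintegral_cst//; apply: le_Rintegral => //.
    - exact: rintegrableS (mB n) (ig m).
    - exact: rintegrableS (mB n) (rintegrable_cst c).
    - by move=> w [/gc].
  have : (c + n.+1%:R^-1) * fine (mu (B n)) <= \int[mu]_(x in B n) h x.
    rewrite -Rintegral_cst//; apply: le_Rintegral => //.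
    - exact: rintegrableS (mB n) (rintegrable_cst _).
    - exact: rintegrableS (mB n) ih.
    - by move=> w [].
  move=> /le_trans/(_ hB1); rewrite mulrDl gerDl pmulr_rle0 ?invr_gt0// => m0.
  rewrite -[mu (B n)]fineK ?fin_num_measure//; congr EFin; apply/eqP.
  by rewrite eq_le m0 fine_ge0.
have : \forall w \ae mu, forall n, ~ B n w.
  apply/ae_foralln => n; exists (B n); split=> //; first exact: small.
  by move=> w /=; exact: contrapT.
apply: filterS => w hw Aw; rewrite leNgt; apply/negP => ch.
have : \forall n \near \oo, n.+1%:R^-1 < h w - c.
  by apply: (cvgr_lt 0); [exact: cvg_harmonic|rewrite subr_gt0].
move=> /filter_ex[n hn]; apply: (hw n); split=> //=.
by rewrite addrC -lerBrDr ltW.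
Qed.

Lemma weak_limit_near_ae g h A (c r : R) : weak_limit g h -> measurable A ->
  (\forall n \near U, forall w, A w -> `|g n w - c| <= r) ->
  \forall w \ae mu, A w -> `|h w - c| <= r.
Proof.
move=> gh mA gc.
(* The lower bound is the upper bound for -g, written as a combination with the zero sequence. *)
have gh' : weak_limit (fun n w => - 1 * g n w + 0) (fun w => -1 * h w + 0).
  apply: (weak_limit_linear (-1) gh (g' := fun _ _ => 0) (h' := fun=> 0)).
  by split=> [|n|B mB]; [exact: rintegrable_cst|exact: rintegrable_cst|exact: cvg_cst].
have h1 := @weak_limit_le _ _ A (c + r) gh mA.
have h2 := @weak_limit_le _ _ A (r - c) gh' mA.
apply: filterS2 (h1 _) (h2 _).
- move=> w {}h1 {}h2 Aw; rewrite ler_norml.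
  by move: (h1 Aw) (h2 Aw); rewrite mulN1r addr0 => ? ?; apply/andP; split; lra.
- apply: filterS gc => n + w Aw => /(_ w Aw); rewrite ler_norml => /andP[? ?]; lra.
- apply: filterS gc => n + w Aw => /(_ w Aw); rewrite ler_norml => /andP[? ?]; lra.
Qed.

(** The zero sequence -g + g has h' - h as a weak limit. *)
Lemma weak_limit_unique g h h' : weak_limit g h -> weak_limit g h' ->
  \forall w \ae mu, h w = h' w.
Proof.
move=> gh gh'; have := weak_limit_near_ae (c := 0) (r := 0)
  (weak_limit_linear (-1) gh gh') measurableT.
move=> H; apply: filterS (H _) => [w /(_ I)|].
  by rewrite subr0 normr_le0 mulN1r addrC subr_eq0 => /eqP.
by apply: nearW => n w _; rewrite subr0 mulN1r addNr normr0.
Qed.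

End weak_limits.

(** * The Asplund property implies fragmentability *)

Section dyadic.
Context {R : realType}.

(* Digit strings list the most recent digit first: [b :: s] is a child of [s]. *)
Fixpoint dyadic_left (s : seq bool) : R :=
  if s is b :: s' then dyadic_left s' + (if b then 2^-1 ^+ size s else 0) else 0.

Fixpoint dyadic_digits (n : nat) (x : R) : seq bool :=
  if n is n'.+1 then
    let s := dyadic_digits n' x in (dyadic_left s + 2^-1 ^+ n <= x) :: s
  else [::].

Lemma size_dyadic_digits n x : size (dyadic_digits n x) = n.
Proof. by elim: n => //= n ->. Qed.

Lemma dyadic_digits_itv n x : 0 <= x < 1 ->
  dyadic_left (dyadic_digits n x) <= x < dyadic_left (dyadic_digits n x) + 2^-1 ^+ n.
Proof.
move=> x01; elim: n => [|n] /=; first by rewrite expr0 add0r.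
rewrite size_dyadic_digits; set l := dyadic_left _ => /andP[lx xl].
have half : 2^-1 ^+ n = 2^-1 ^+ n.+1 + 2^-1 ^+ n.+1 :> R.
  by rewrite exprS; lra.
have [h|h] := leP (l + 2^-1 ^+ n.+1) x; last by rewrite addr0 lx h.
by rewrite h -addrA -half.
Qed.

Lemma measurable_dyadic_digits n s :
  measurable ([set x | dyadic_digits n x = s] : set (measurableTypeR R)).
Proof.
elim: n s => [|n IH] [|b s] /=.
- by rewrite (_ : [set _ | _] = setT)//; apply/seteqP; split.
- by rewrite (_ : [set _ | _] = set0)//; apply/seteqP; split.
- by rewrite (_ : [set _ | _] = set0)//; apply/seteqP; split.
rewrite (_ : [set _ | _] = [set x | dyadic_digits n x = s] `&`
   [set x | (dyadic_left s + 2^-1 ^+ n.+1 <= x) = b]); last first.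
  by apply/seteqP; split=> x /=; [case=> <- <-|case=> -> ->].
apply: measurableI => //; case: b.
  rewrite (_ : [set _ | _] = `[dyadic_left s + 2^-1 ^+ n.+1, +oo[%classic)//.
  by apply/seteqP; split=> x /=; rewrite in_itv/= andbT.
rewrite (_ : [set _ | _] = `]-oo, dyadic_left s + 2^-1 ^+ n.+1[%classic)//.
by apply/seteqP; split=> x /=; rewrite in_itv/= ltNge; [move=> ->|move=> /negbTE].
Qed.

(** For Lebesgue measure restricted to [0, 1[, a cylinder of order n sits in an interval of length
    2^-n. *)
Lemma dyadic_space : exists (mu : {finite_measure set (measurableTypeR R) -> \bar R}),
  mu setT = 1%E /\
  forall n s, (mu [set x | dyadic_digits n x = s] <= (2^-1 ^+ n)%:E)%E.
Proof.
pose I (a b : R) : set (measurableTypeR R) := `[a, b[%classic.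
have mI a b : measurable (I a b) by exact: measurable_itv.
have l1 : lebesgue_measure (I 0 1) = 1%E :> \bar R.
  by rewrite lebesgue_measure_itv/= lte_fin ltr01 oppr0 adde0.
have fin : (lebesgue_measure (I 0%R 1%R) < +oo)%E by rewrite l1 ltry.
exists (mfrestr (mI 0 1) fin); split.
  by transitivity (lebesgue_measure (setT `&` I 0 1)) => //; rewrite setTI.
move=> n s; pose A : set (measurableTypeR R) :=
  [set x | dyadic_digits n x = s] `&` I 0 1.
suff : (lebesgue_measure A <= (2^-1 ^+ n)%:E)%E by [].
have sub : A `<=` I (dyadic_left s) (dyadic_left s + 2^-1 ^+ n).
  by move=> x [/= <-]; rewrite /I /= !in_itv/= => /(dyadic_digits_itv n).
have mA : measurable (A : set (measurableTypeR R)).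
  by apply: measurableI => //; exact: measurable_dyadic_digits.
apply: (@le_trans _ _ (lebesgue_measure (I (dyadic_left s) (dyadic_left s + 2^-1 ^+ n)))).
  by apply: le_measure; rewrite ?inE.
rewrite lebesgue_measure_itv/= lte_fin ltrDl exprn_gt0 ?invr_gt0//.
by rewrite -EFinD addrC addKr.
Qed.

End dyadic.

Section separation.
Context {R : realType} {k : scalars} {E : normedModType (scalar_field R k)}.
Local Notation K := (scalar_field R k).

Lemma not_small_diam (A : set (wstar_dual E)) (eps : R) : ~ (dual_diam A <= eps%:E)%E ->
  exists (f g : wstar_dual E) (x : E), [/\ A f, A g, `|x| <= 1 &
    eps < sabs ((f : dual E) x - (g : dual E) x)].
Proof.
move=> nd; apply: contrapT => h; apply: nd; apply/dual_diam_leP => f g Af Ag x x1.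
by rewrite leNgt; apply/negP => fg; apply: h; exists f, g, x.
Qed.

Lemma dual_ball_le (f : dual E) (y : E) : @dual_ball R k E f -> sabs ((f : E -> K) y) <= sre `|y|.
Proof.
move=> /functional_norm_leP fb; have [->|y0] := eqVneq y 0.
  by rewrite linear0 sabs0 normr0 -sof0 sre_sof.
have ny : `|y| != 0 by rewrite normr_eq0.
have : `| (`|y|^-1 *: y) | <= 1 by rewrite normrZ normfV normr_id mulVf.
move=> /fb; rewrite linearZ/= [_ *: _]/(_ * _) sabsM.
rewrite -(@le_sof R k) sofM !sof_sabs normfV normr_id sof1.
by rewrite ler_pdivrMl ?normr_gt0// mulr1 -(@le_sof R k) sof_sabs sof_norm.
Qed.

(** Two functionals in [A] and [V s] differ by more than eps at some [x s] in the unit ball. The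
    children of [V s] are cut out by discs of radius e around their values [a s b] at [x s], so they
    are open and meet [A] again. *)
Lemma nonfragmented_tree (A : set (wstar_dual E)) (eps : R) : A !=set0 -> 0 < eps ->
  (forall V : set (wstar_dual E), open V -> A `&` V !=set0 ->
    ~ (dual_diam (A `&` V) <= eps%:E)%E) ->
  forall e, 0 < e ->
  exists (V : seq bool -> set (wstar_dual E)) (x : seq bool -> E) (a : seq bool -> bool -> K),
    [/\ forall s, A `&` V s !=set0,
        forall b s, V (b :: s) `<=` V s,
        forall s, `|x s| <= 1,
        forall s, eps < sabs (a s true - a s false) &
        forall b s g, V (b :: s) g -> sabs ((g : dual E) (x s) - a s b) < e].
Proof.
move=> A0 eps0 big e e0.
have /choice[F hF] (V : set (wstar_dual E)) :
  exists t : (bool -> set (wstar_dual E)) * E * (bool -> K),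
  open V -> A `&` V !=set0 -> [/\ `|t.1.2| <= 1,
    eps < sabs (t.2 true - t.2 false) &
    forall b, [/\ open (t.1.1 b), A `&` t.1.1 b !=set0, t.1.1 b `<=` V &
      forall g, t.1.1 b g -> sabs ((g : dual E) t.1.2 - t.2 b) < e]].
  (* The splitting is made a total function of [V], with dummy values when [V] is not open or misses
     [A]. *)
  have [oV|] := pselect (open V); last by exists (fun=> set0, 0, fun=> 0).
  have [AV|] := pselect (A `&` V !=set0); last by exists (fun=> set0, 0, fun=> 0).
  have [f [g [x [[Af Vf] [Ag Vg] x1 fg]]]] := not_small_diam (big V oV AV).
  pose h (b : bool) : wstar_dual E := if b then f else g.
  pose W b := V `&` [set u : wstar_dual E | sabs ((u : dual E) x - (h b : dual E) x) < e].
  exists (W, x, fun b => (h b : dual E) x) => _ _; split=> //= b; split.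
  - by apply: openI => //; exact: wstar_open_disc.
  - exists (h b); split; first by case: b.
    by split; [case: b|rewrite /= subrr sabs0].
  - by move=> u [].
  - by move=> u [].
pose V := fix V (s : seq bool) := if s is b :: s' then (F (V s')).1.1 b else setT.
have hV s : open (V s) /\ A `&` V s !=set0.
  elim: s => [|b s [oV AV]] /=; first by split; [exact: openT|rewrite setIT].
  by have [_ _ /(_ b)[]] := hF _ oV AV.
exists V, (fun s => (F (V s)).1.2), (fun s => (F (V s)).2); split.
- by move=> s; case: (hV s).
- by move=> b s /=; have [oV AV] := hV s; have [_ _ /(_ b)[]] := hF _ oV AV.
- by move=> s; have [oV AV] := hV s; have [] := hF _ oV AV.
- by move=> s; have [oV AV] := hV s; have [] := hF _ oV AV.
- by move=> b s g /=; have [oV AV] := hV s; have [_ _ /(_ b)[_ _ _]] := hF _ oV AV; apply.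
Qed.

End separation.

Section weak_limit_operator.
Context {R : realType} {k : scalars} {F : normedModType (scalar_field R k)}.
Local Notation K := (scalar_field R k).
Context {d} {Omega : measurableType d}.
Variable mu : {finite_measure set Omega -> \bar R}.
Variables (U : set_system nat) (UU : UltraFilter U).

Lemma Linfty_ext (u v : Linfty k mu) : (\forall w \ae mu, repr u w = repr v w) -> u = v.
Proof.
move=> uv; rewrite -[u]reprK -[v]reprK; apply/Linfty_eqP.
by apply: filterS uv => w ->.
Qed.

(** Weak limits of the real and imaginary parts are unique almost everywhere, hence linear in [y].
    The two parts are estimated separately, which doubles [r]. *)
Lemma weak_limit_operator (phi : nat -> Omega -> dual F) :
  (forall n w, @dual_ball R k F (phi n w)) ->
  (forall n y, smeasurable (fun w => (phi n w : F -> K) y)) ->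
  exists S : operator F (Linfty k mu), forall y (A : set Omega) (c : K) (r : R),
    measurable A ->
    (\forall n \near U, forall w, A w -> sabs ((phi n w : F -> K) y - c) <= r) ->
    \forall w \ae mu, A w -> sabs (repr (S y) w - c) <= r + r.
Proof.
move=> phib mphi.
pose gr y n w := sre ((phi n w : F -> K) y).
pose gi y n w := sim ((phi n w : F -> K) y).
have hb n w y := dual_ball_le y (phib n w).
have /choice[hr hrE] y : exists h, weak_limit mu U (gr y) h.
  apply: (@weak_limit_exists _ _ _ mu U UU _ (sre `|y|)) => [n|n w].
    by case: (mphi n y).
  by rewrite (le_trans (le_sre_sabs _)).
have /choice[hi hiE] y : exists h, weak_limit mu U (gi y) h.
  apply: (@weak_limit_exists _ _ _ mu U UU _ (sre `|y|)) => [n|n w].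
    by case: (mphi n y).
  by rewrite (le_trans (le_sim_sabs _)).
pose H y w : K := smk (hr y w) (hi y w).
(* For real scalars [smk] drops [hi y], but then [hi y] is a weak limit of zeros and vanishes almost
   everywhere. *)
have simH y : \forall w \ae mu, sim (H y w) = hi y w.
  have [k0|k0] : k = RealScalars \/ k <> RealScalars by case: (k); [left|right].
    have := @weak_limit_near_ae _ _ _ mu U UU _ _ setT 0 0 (hiE y) measurableT.
    move=> h0; apply: filterS (h0 _) => [w /(_ I)|].
      by rewrite subr0 normr_le0 => /eqP hi0; apply: sim_smk.
    by apply: nearW => n w _; rewrite /gi sim_real// subr0 normr0.
  by apply: nearW => w; exact: sim_smk.
have near_H y (A : set Omega) (c : K) (r : R) : measurable A ->
    (\forall n \near U, forall w, A w -> sabs ((phi n w : F -> K) y - c) <= r) ->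
    \forall w \ae mu, A w -> sabs (H y w - c) <= r + r.
  move=> mA near_c.
  have h1 : \forall w \ae mu, A w -> `|hr y w - sre c| <= r.
    apply: weak_limit_near_ae (hrE y) mA _; apply: filterS near_c => n + w Aw.
    by move=> /(_ w Aw); apply: le_trans; rewrite /gr -sreB le_sre_sabs.
  have h2 : \forall w \ae mu, A w -> `|hi y w - sim c| <= r.
    apply: weak_limit_near_ae (hiE y) mA _; apply: filterS near_c => n + w Aw.
    by move=> /(_ w Aw); apply: le_trans; rewrite /gi -simB le_sim_sabs.
  apply: filterS3 h1 h2 (simH y) => w h1 h2 h3 Aw.
  rewrite (le_trans (sabs_le_reim _))// sreB simB h3 sre_smk lerD//; [exact: h1|exact: h2].
have mH y : smeasurable (H y).
  split.
    rewrite (_ : _ \o _ = hr y); first by have [/rintegrable_measurable] := hrE y.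
    by apply/funext => w; exact: sre_smk.
  have [k0|k0] : k = RealScalars \/ k <> RealScalars by case: (k); [left|right].
    rewrite (_ : _ \o _ = cst 0); first exact: measurable_cst.
    by apply/funext => w /=; exact: sim_real.
  rewrite (_ : _ \o _ = hi y); first by have [/rintegrable_measurable] := hiE y.
  by apply/funext => w; exact: sim_smk.
have bH y : \forall w \ae mu, sabs (H y w) <= sre `|y| + sre `|y|.
  have h := near_H y setT 0 (sre `|y|) measurableT.
  apply: filterS (h _) => [w /(_ I)|]; first by rewrite subr0.
  by apply: nearW => n w _; rewrite subr0.
have linH a y z : \forall w \ae mu, H (a *: y + z) w = a * H y w + H z w.
  have phiP n w : (phi n w : F -> K) (a *: y + z) = a * (phi n w : F -> K) y + (phi n w : F -> K) z.
    by rewrite linearP.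
  have h1 := weak_limit_linear UU (sre a) (hrE y) (weak_limit_linear UU (- sim a) (hiE y) (hrE z)).
  have h2 := weak_limit_linear UU (sre a) (hiE y) (weak_limit_linear UU (sim a) (hrE y) (hiE z)).
  have e1 : gr (a *: y + z) = fun n w => sre a * gr y n w + (- sim a * gi y n w + gr z n w).
    by apply/funext => n; apply/funext => w; rewrite /gr phiP sreD sreM -addrA mulNr.
  have e2 : gi (a *: y + z) = fun n w => sre a * gi y n w + (sim a * gr y n w + gi z n w).
    by apply/funext => n; apply/funext => w; rewrite /gi phiP simD simM -addrA.
  have := weak_limit_unique UU (hrE (a *: y + z)); rewrite e1 => /(_ _ h1) u1.
  have := weak_limit_unique UU (hiE (a *: y + z)); rewrite e2 => /(_ _ h2) u2.
  near=> w; apply: scalar_ext.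
    rewrite sreD sreM !sre_smk (near u1 w)//.
    by rewrite (near (simH y) w)// mulNr addrA.
  rewrite simD simM !sre_smk (near (simH (a *: y + z)) w)// (near u2 w)//.
  by rewrite (near (simH y) w)// (near (simH z) w)// addrA.
have /choice[S0 S0E] y : exists u : Linfty k mu, (repr u : Omega -> K) = H y %[ae mu].
  exact: exists_Linfty (mH y) (bH y).
have linS : linear S0.
  move=> a y z; apply: Linfty_ext; near=> w.
  rewrite (near (Linfty_repr_linear a (S0 y) (S0 z)) w)//.
  rewrite (near (S0E (a *: y + z)) w)// (near (S0E y) w)// (near (S0E z) w)//.
  by rewrite (near (linH a y z) w).
have bS y : `|S0 y| <= sof 2 * `|y|.
  have n0 : 0 <= sre `|y| by rewrite -(@le_sof R k) sof_norm sof0.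
  rewrite -sof_norm -sofM; apply/Linfty_norm_leP; first by rewrite mulr_ge0.
  by apply: filterS2 (S0E y) (bH y) => w /(_ I) -> ?; lra.
have [S SE] := exists_operator linS bS.
exists S => y A c r mA /(near_H y A c r mA).
by apply: filterS2 (S0E y) => w; rewrite SE => /(_ I) ->.
Unshelve. all: by end_near. Qed.

End weak_limit_operator.

Section essential_constancy.
Context {R : realType} {k : scalars} {d} {Omega : measurableType d}.
Variable mu : {measure set Omega -> \bar R}.
Local Notation K := (scalar_field R k).

Lemma precompact_finite_net (A : set (Linfty k mu)) (e : R) : precompact A -> 0 < e ->
  exists (I : finType) (L : I -> Linfty k mu), forall u, A u -> exists i, `|u - L i| <= sof e.
Proof.
move=> [C AC [cC _]] e0; move: cC; rewrite compact_cover.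
pose ba (c : Linfty k mu) := ball c (sof e).
have se0 : (0 : K) < sof e by rewrite -sof0 lt_sof.
move=> /(_ _ setT ba)[|u _|D _ CD].
- by move=> u _; exact: ball_open.
- by exists u => //; exact: ballxx.
exists D, (fun i => val i) => u /AC/CD[c cD]; rewrite /ba -ball_normE /ball_ /= => uc.
by exists (FSetSub cD); rewrite distrC ltW.
Qed.

(** Along a conull ultrafilter containing [B], each of the finitely many [L i] is close to its limit
    on a member; the intersection of these members belongs to the ultrafilter, so it is not null. *)
Lemma nearly_constant_piece (I : finType) (L : I -> Linfty k mu) (B : set Omega) (e : R) :
  0 < e -> measurable B -> (0 < mu B)%E ->
  exists (P : set Omega) (c : I -> K), [/\ P `<=` B, measurable P, (0 < mu P)%E &
    forall i w, P w -> sabs (repr (L i) w - c i) < e].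
Proof.
move=> e0 mB B0.
have /(positive_not_ae _ mB)/not_ae_ultra[U [UU aeU UB]] := B0.
have sb i : sbounded U (repr (L i)).
  exists (sre `|L i|); apply: aeU; apply/Linfty_norm_leP; last by rewrite sof_norm.
  by rewrite -(@le_sof R k) sof_norm sof0.
pose c i := slim U (repr (L i)).
pose Q i := [set w | sabs (repr (L i) w - c i) < e].
have mQ i : measurable (Q i).
  have := smeasurable_sabs (smeasurableD (smeasurable_repr (L i)) (smeasurable_cst (- c i))).
  move=> /(_ measurableT _ (measurable_itv `]-oo, e[)); rewrite setTI.
  by congr (measurable _); apply/seteqP; split=> w /=; rewrite in_itv.
have mP : measurable (B `&` \bigcap_i Q i).
  by apply: measurableI => //; apply: fin_bigcap_measurable.
exists (B `&` \bigcap_i Q i), c; split=> //.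
- apply/(positive_not_ae _ mP) => /aeU h.
  have : U (~` (B `&` \bigcap_i Q i) `&` (B `&` \bigcap_i Q i)).
    apply: filterI => //; apply: filterI => //.
    have : U [set w | forall i, Q i w].
      apply: filter_forall => i; apply: slim_dist_lt; first exact: sb.
      by rewrite subrr sabs0.
    by apply: filterS => w Qw i _; exact: Qw.
  by move=> /filter_ex[w []].
- by move=> i w [_]; apply.
Qed.

End essential_constancy.

Section Asplund_fragmented.
Context {R : realType} {k : scalars} {E F : normedModType (scalar_field R k)}.
Local Notation K := (scalar_field R k).

Lemma Asplund_fragmented (T : operator E F) : Asplund T -> fragmented (adjoint_ball T).
Proof.
move=> aspT eps A eps0 AK A0; apply: contrapT => nV.
have big (V : set (wstar_dual E)) : open V -> A `&` V !=set0 ->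
    ~ (dual_diam (A `&` V) <= eps%:E)%E.
  by move=> oV AV dV; apply: nV; exists V.
(* The image of [x s] is within 2 * eps / 16 of [a s b] on the cylinder of b :: s, and within 2 *
   eps / 16 of one constant on [P]. Both [a s b] are then within eps / 4 of that constant, against
   their distance eps. *)
have e0 : 0 < eps / 16 by rewrite divr_gt0.
have [V [x [a [AV VS x1 aeps Va]]]] := nonfragmented_tree A0 eps0 big e0.
have /choice[phi phiE] (s : seq bool) : exists f : dual F, @dual_ball R k F f /\
    V s (adjoint T f).
  by have [g [/AK[f fb <-] Vg]] := AV s; exists f.
have [mu [mu1 mu_digits]] := @dyadic_space R.
have [U [UU oU]] := exists_ultra_oo.
pose f n (w : measurableTypeR R) := phi (dyadic_digits n w).
(* The digit strings form a countable type, so every set of strings has a measurable preimage. *)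
have mdig n (D : set (seq bool)) :
    measurable ([set w | D (dyadic_digits n w)] : set (measurableTypeR R)).
  rewrite (_ : [set _ | _] = \bigcup_s
      [set w | D s /\ dyadic_digits n w = s]); last first.
    by apply/seteqP; split=> [w Dw|w [s _ [Ds /= ds]]]; [exists (dyadic_digits n w)|rewrite ds].
  apply: countable_bigcupT_measurable => // s.
  have [Ds|nDs] := pselect (D s); last first.
    by rewrite (_ : [set _ | _] = set0)//; apply/seteqP; split=> // w [].
  rewrite (_ : [set _ | _] = [set w | dyadic_digits n w = s]).
    exact: measurable_dyadic_digits.
  by apply/seteqP; split=> [w []|].
have [|n y|S hS] := @weak_limit_operator R k F _ _ mu U UU f.
- by move=> n w; case: (phiE (dyadic_digits n w)).
- split=> _ B mB; rewrite setTI.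
    exact: (mdig n [set s | B (sre ((phi s : F -> K) y))]).
  exact: (mdig n [set s | B (sim ((phi s : F -> K) y))]).
pose cyl (s : seq bool) := [set w : measurableTypeR R | dyadic_digits (size s) w = s].
have mcyl s : measurable (cyl s) by exact: measurable_dyadic_digits.
have Vcyl s n w : (size s <= n)%N -> cyl s w -> V (dyadic_digits n w) `<=` V s.
  elim: n => [|n IH]; first by rewrite leqn0 => /eqP s0; rewrite /cyl/= s0 => <-.
  rewrite leq_eqVlt => /orP[/eqP <-|]; first by rewrite /cyl/= => ->.
  by rewrite ltnS => sn cw; apply: subset_trans (IH sn cw); exact: VS.
have STcyl s b : \forall w \ae mu, cyl (b :: s) w ->
    sabs (repr (S (T (x s))) w - a s b) <= eps / 16 + eps / 16.
  apply: (hS (T (x s)) (cyl (b :: s)) (a s b) (eps / 16)) => //.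
  apply: oU; exists (size s).+1 => // n /= sn w cw; apply/ltW.
  apply: (Va b s (adjoint T (f n w))); apply: (Vcyl _ n) cw _ _ => //.
  by case: (phiE (dyadic_digits n w)).
have half0 : 0 < 2^-1 :> R by rewrite invr_gt0.
(* As [mu] has total mass 1, losing at most 1 / 2 leaves a set of positive measure. *)
have [B [mB [Bhalf /precompact_finite_net pcB]]] := aspT _ _ mu S _ half0.
have B0 : (0 < mu B)%E.
  by apply: le_lt_trans Bhalf; rewrite mu1 -EFinB lee_fin; lra.
have [I [L hL]] := pcB _ e0.
have [P [c [PB mP P0 hc]]] := nearly_constant_piece L e0 mB B0.
have STP e : `|e| <= 1 -> exists c', \forall w \ae mu, P w ->
    sabs (repr (S (T e)) w - c') <= eps / 16 + eps / 16.
  move=> e1; have [|i hi] := hL (Linfty_mul_indic mB (S (T e))).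
    by exists (S (T e)) => //; exists e.
  exists (c i); move: hi => /(Linfty_distP _ _ (ltW e0)).
  have := Linfty_repr (LinfFun (Linf_mul_indic_subproof mB (repr (S (T e))))).
  apply: filterS2 => w /(_ Logic.I) /= -> h Pw; move: h.
  rewrite indicE mem_set ?mulr1; last exact: PB.
  move=> h; rewrite (le_trans (sabs_dist (repr (L i) w) _ _))// lerD//.
  by rewrite ltW// hc.
(* Otherwise [P] would be concentrated on a single branch of cylinders, whose
   measures tend to 0. *)
have [s hs] : exists s, forall b, ~ \forall w \ae mu, ~ (P `&` cyl (b :: s)) w.
  apply: contrapT => ns.
  have H n : exists2 s, size s = n & \forall w \ae mu, P w -> cyl s w.
    elim: n => [|n [s sn Ps]]; first by exists [::] => //; apply: nearW.
    have [b hb] : exists b, \forall w \ae mu, ~ (P `&` cyl (b :: s)) w.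
      apply: contrapT => nb; apply: ns; exists s => b hb.
      by apply: nb; exists b.
    exists (~~ b :: s); first by rewrite /= sn.
    apply: filterS2 hb Ps => w hb Ps Pw; have := Ps Pw; rewrite /cyl/= => es.
    rewrite es; congr (_ :: _); move: hb; rewrite /cyl/= es.
    by case: (_ <= _) => hb; case: b hb => // hb; case: hb.
  have : \forall n \near \oo, 2^-1 ^+ n < fine (mu P).
    apply: (cvgr_lt 0).
      by apply: cvg_expr; rewrite ger0_norm ?invr_ge0// invf_lt1 ?ltr1n.
    by rewrite fine_gt0// P0 -ge0_fin_numE// fin_num_measure.
  move=> /filter_ex[n hn]; have [s sn Ps] := H n.
  have : (mu P <= mu (cyl s))%E.
    have [N [mN N0 subN]] := Ps.
    rewrite (_ : mu (cyl s) = mu (cyl s `|` N)); last by rewrite measureU0.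
    apply: le_measure; [exact: mem_set|exact: mem_set (measurableU _ _ (mcyl s) mN)|].
    move=> w Pw; have [cw|ncw] := pselect (cyl s w); first by left.
    by right; apply: subN => /(_ Pw).
  move=> /le_trans/(_ (mu_digits _ _)).
  rewrite -[mu P]fineK ?fin_num_measure// lee_fin sn leNgt hn.
  by [].
have [c' hc'] := STP (x s) (x1 s).
(* By the choice of [s], [P] meets the cylinder of b :: s in a nonnull set, so both estimates hold
   at a common point. *)
have pt b : sabs (a s b - c') <= eps / 4.
  apply: contrapT => nab; apply: (hs b).
  apply: filterS2 hc' (STcyl s b) => w h1 h2 [/h1 {}h1 /h2 {}h2]; apply: nab.
  rewrite (le_trans (sabs_dist (repr (S (T (x s))) w) _ _))// [X in X + _]sabsC.
  by lra.
have := aeps s; apply/negP; rewrite -leNgt.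
rewrite (le_trans (sabs_dist c' _ _))// [X in _ + X]sabsC.
by have := pt true; have := pt false; lra.
Qed.

End Asplund_fragmented.

Theorem proposition2p10 (R : realType) (k : scalars)
    (E F : completeNormedModType (scalar_field R k)) (T : operator E F) :
  (exists a : ord, Szlenk_operator a T) <-> Asplund T.
Proof.
rewrite /Szlenk_operator /Sz_op; split=> [/Sz_fragmented fragT|aspT].
  move=> d Omega mu S eps eps0; have [M M0 SM] := operator_bound S.
  exact: (fragmented_precompact fragT M0 SM eps0).
by apply/Sz_fragmented; exact: Asplund_fragmented.
Qed.
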